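(* Let $\mathbb{T}$ and $\mathbb{T}'$ be $\omega$-stable single-sorted relational coherent theories. The canonical extensions of their associated syntactic doctrines are isomorphic, $D_{\mathbb{T}}^\delta \cong D_{\mathbb{T}'}^\delta$, if and only if their categories of countable, saturated models are equivalent over $\mathbf{Set}$, $\omega\mathrm{Sat}(\mathbb{T}) \simeq_{\mathbf{Set}} \omega\mathrm{Sat}(\mathbb{T}')$.
   Context: Coherent formulae are built from atomic formulae (including equality) with $\wedge, \vee, \top, \bot, \exists$; a coherent theory is a set of sequents $\phi(x) \vdash \psi(x)$ between coherent formulae, interpreted as ''for all $x$, $\phi(x)$ implies $\psi(x)$''. All theories are single-sorted and relational (no function symbols). Morphisms of models are homomorphisms of structures. The syntactic doctrine $D_{\mathbb{T}} \colon \mathbf{FinSet} \to \mathbf{DL}$ ($\mathbf{DL}$ the category of bounded distributive lattices and bounded lattice morphisms) sends a finite set $X$ to the lattice of coherent formulae with free variables in $X$ modulo $\mathbb{T}$-provable equivalence, and a function to the corresponding substitution map. The canonical extension $L^\delta \supseteq L$ of a distributive lattice $L$ is the unique (up to isomorphism fixing $L$) completion of $L$ in which every element is a join of meets of subsets of $L$ and a meet of joins of subsets of $L$, and such that $\bigwedge S \leq \bigvee T$ with $S,T\subseteq L$ implies $\bigwedge S' \leq \bigvee T'$ for some finite $S'\subseteq S,T'\subseteq T$. A lattice morphism $f \colon L \to K$ extends uniquely to a map $f^\delta \colon L^\delta \to K^\delta$ preserving arbitrary joins and meets. $D_{\mathbb{T}}^\delta$ is the composite of $D_{\mathbb{T}}$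 with $(-)^\delta$, and $D_{\mathbb{T}}^\delta \cong D_{\mathbb{T}'}^\delta$ means that these functors on $\mathbf{FinSet}$ are naturally isomorphic. For disjoint sets of variables $X,Y$, a $Y$-type with $X$-parameters in a model $\mathcal{M}$ with underlying set $M$ is a pair $(\tau,m)$, $\tau$ a set of coherent formulae with free variables in $X \cup Y$, considered closed under finite conjunctions, and $m \in M^X$. It is consistent if for every $\phi \in \tau$ there is $n \in M^Y$ with $\mathcal{M} \models \phi(m,n)$, and realised if there is $n \in M^Y$ with $\mathcal{M} \models \phi(m,n)$ for every $\phi \in \tau$. $\mathcal{M}$ is $\omega$-saturated if, for any finite $X,Y$, every consistent $Y$-type with $X$-parameters in $\mathcal{M}$ is realised. A model is countable and saturated if its underlying set is (at most) countable and it is $\omega$-saturated; $\omega\mathrm{Sat}(\mathbb{T})$ is the category of countable, saturated models of $\mathbb{T}$ and all model homomorphisms, with its forgetful functor to $\mathbf{Set}$. $\mathbb{T}$ is $\omega$-stable if, for any model $\mathcal{M}$ of $\mathbb{T}$ and any countable subset $A \subseteq M$, there are (at most) countably many prime types with parameters in $A$. Here, for a finite set of variables $Y$, a prime $Y$-type with parameters in $A$ is a filter $\tau$ (with respect to $\mathbb{T}$-provable entailment, parameters being treated as additional variables) of formulae $\phi(a,y)$, where $\phi$ is coherent, $a$ is a finite tuple from $A$ and $y$ are variables in $Y$, which is prime ($\bot \notin \tau$, and $\phi \vee \psi \in \tau$ implies $\phi \in \tau$ or $\psi \in \tau$) and consistent in $\mathcal{M}$ (each $\phi(a,y) \in \tau$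 is satisfied in $\mathcal{M}$ by some $n \in M^Y$). Types that have the same free variables $Y$ and the same formulae with parameters are identified. Categories $\mathcal{A}, \mathcal{B}$ equipped with functors $A \colon \mathcal{A} \to \mathcal{E}$, $B \colon \mathcal{B} \to \mathcal{E}$ are equivalent over $\mathcal{E}$, written $\mathcal{A} \simeq_{\mathcal{E}} \mathcal{B}$, if there are functors $F \colon \mathcal{A} \to \mathcal{B}$, $G \colon \mathcal{B} \to \mathcal{A}$ witnessing an equivalence of categories with $B F = A$ and $A G = B$, so that $A$ and $B$ are equivalent as objects of the slice $\mathbf{CAT}/\mathcal{E}$. *)

(* Defs.v *)
From HB Require Import structures.
From mathcomp Require Import all_boot all_order.
From mathcomp Require Import boolp classical_sets functions cardinality.

Set Implicit Arguments.
Unset Strict Implicit.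
Unset Printing Implicit Defensive.

Import Order.TTheory.

Local Open Scope classical_set_scope.
Local Open Scope order_scope.
Local Open Scope quotient_scope.

Record category := Category {
  ob :> Type;
  hom : ob -> ob -> Type;
  idm : forall x, hom x x;
  comp : forall x y z, hom y z -> hom x y -> hom x z;
  comp1m : forall x y (f : hom x y), comp (idm y) f = f;
  compm1 : forall x y (f : hom x y), comp f (idm x) = f;
  compA : forall x y z t (h : hom z t) (g : hom y z) (f : hom x y),
    comp h (comp g f) = comp (comp h g) f
}.
Arguments hom {c}.
Arguments idm {c} x.
Arguments comp {c x y z}.

Record functor (C D : category) := Functor {
  fob :> C -> D;
  fmap : forall x y, hom x y -> hom (fob x) (fob y);
  fmap1 : forall x, fmap (idm x) = idm (fob x);
  fmapM : forall x y z (g : hom y z) (f : hom x y),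
    fmap (comp g f) = comp (fmap g) (fmap f)
}.
Arguments fmap {C D} f {x y} : rename.

Definition id_functor (C : category) : functor C C :=
  @Functor C C id (fun _ _ f => f) (fun _ => erefl) (fun _ _ _ _ _ => erefl).

Lemma comp_fmap1 (C D E : category) (G : functor D E) (F : functor C D) x :
  fmap G (fmap F (idm x)) = idm (G (F x)).
Proof. by rewrite !fmap1. Qed.

Lemma comp_fmapM (C D E : category) (G : functor D E) (F : functor C D)
    x y z (g : hom y z) (f : hom x y) :
  fmap G (fmap F (comp g f)) =
  comp (fmap G (fmap F g)) (fmap G (fmap F f)).
Proof. by rewrite !fmapM. Qed.

Definition comp_functor (C D E : category) (G : functor D E) (F : functor C D) :
    functor C E :=
  @Functor C E (fun x => G (F x)) (fun _ _ f => fmap G (fmap F f))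
    (@comp_fmap1 C D E G F) (@comp_fmapM C D E G F).

Record nat_iso (C D : category) (F G : functor C D) := NatIso {
  ni_fwd : forall x, hom (F x) (G x);
  ni_bwd : forall x, hom (G x) (F x);
  ni_natural : forall x y (f : hom x y),
    comp (ni_fwd y) (fmap F f) = comp (fmap G f) (ni_fwd x);
  ni_fwdK : forall x, comp (ni_bwd x) (ni_fwd x) = idm (F x);
  ni_bwdK : forall x, comp (ni_fwd x) (ni_bwd x) = idm (G x)
}.

Definition naturally_isomorphic (C D : category) (F G : functor C D) : Prop :=
  inhabited (nat_iso F G).

(* A morphism which is an identity up to an equality between its source and   *)
(* its target.                                                                *)
Inductive is_identity (C : category) : forall x y : C, hom x y -> Prop :=
  IsIdentity x : @is_identity C x x (idm x).

(* Equivalence in the slice 2-category CAT/E: the triangles of functors       *)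
(* commute strictly, and the 2-cells are the natural transformations lying    *)
(* over identities of E.                                                      *)
Definition equivalent_over (E A B : category) (U : functor A E)
    (V : functor B E) : Prop :=
  exists (F : functor A B) (G : functor B A)
    (eta : nat_iso (comp_functor G F) (id_functor A))
    (eps : nat_iso (comp_functor F G) (id_functor B)),
  [/\ comp_functor V F = U,
      comp_functor U G = V,
      forall x, is_identity (fmap U (ni_fwd eta x)) &
      forall y, is_identity (fmap V (ni_fwd eps y))].

Definition Sets : category :=
  @Category Type (fun A B => A -> B) (fun _ x => x)
    (fun _ _ _ g f x => g (f x))
    (fun _ _ _ => erefl) (fun _ _ _ => erefl) (fun _ _ _ _ _ _ _ => erefl).

Definition FinSet : category :=
  @Category finType (fun A B => A -> B) (fun _ x => x)
    (fun _ _ _ g f x => g (f x))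
    (fun _ _ _ => erefl) (fun _ _ _ => erefl) (fun _ _ _ _ _ _ _ => erefl).

Fact lattice_display : Order.disp_t. Proof. exact: Order.Disp tt tt. Qed.

(* MathComp's {tblmorphism L -> K} only asks for preservation of the bounds,  *)
(* so it cannot be used here.                                                 *)
Record lattice_hom d d' (L : tbLatticeType d) (K : tbLatticeType d') :=
  LatticeHom {
    lhom :> L -> K;
    lhomI : Order.meet_morphism lhom;
    lhomU : Order.join_morphism lhom;
    lhom0 : lhom \bot = \bot;
    lhom1 : lhom \top = \top
  }.

Lemma lattice_hom_eq d d' (L : tbLatticeType d) (K : tbLatticeType d')
  (f g : lattice_hom L K) : f =1 g -> f = g.
Proof.
case: f g => [f fI fU f0 f1] [g gI gU g0 g1] /= /funext fg.
by case: _ / fg in gI gU g0 g1 *; congr LatticeHom; exact: Prop_irrelevance.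
Qed.

Definition lattice_id d (L : tbLatticeType d) : lattice_hom L L :=
  @LatticeHom _ _ L L id (fun _ _ => erefl) (fun _ _ => erefl) erefl erefl.

Section LatticeComp.
Context d1 d2 d3 (L : tbLatticeType d1) (K : tbLatticeType d2)
  (H : tbLatticeType d3) (g : lattice_hom K H) (f : lattice_hom L K).

Lemma lattice_compI : Order.meet_morphism (g \o f).
Proof. by move=> x y /=; rewrite !lhomI. Qed.

Lemma lattice_compU : Order.join_morphism (g \o f).
Proof. by move=> x y /=; rewrite !lhomU. Qed.

Lemma lattice_comp0 : (g \o f) \bot = \bot.
Proof. by rewrite /= !lhom0. Qed.

Lemma lattice_comp1 : (g \o f) \top = \top.
Proof. by rewrite /= !lhom1. Qed.

Definition lattice_comp : lattice_hom L H :=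
  LatticeHom lattice_compI lattice_compU lattice_comp0 lattice_comp1.
End LatticeComp.

Definition DL : category.
Proof.
refine (@Category (tbDistrLatticeType lattice_display)
  (fun L K => lattice_hom L K) (fun L => lattice_id L)
  (fun _ _ _ g f => lattice_comp g f) _ _ _);
  by move=> *; exact: lattice_hom_eq.
Defined.

Record complete_lattice := CompleteLattice {
  cl_sort :> tbLatticeType lattice_display;
  sup : set cl_sort -> cl_sort;
  inf : set cl_sort -> cl_sort;
  supP : forall A, supremums A (sup A);
  infP : forall A, infimums A (inf A)
}.
Arguments sup {c}.
Arguments inf {c}.

Record complete_hom (C D : complete_lattice) := CompleteHom {
  chom :> C -> D;
  chom_sup : forall A, chom (sup A) = sup (chom @` A);
  chom_inf : forall A, chom (inf A) = inf (chom @` A)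
}.

Lemma complete_hom_eq (C D : complete_lattice) (f g : complete_hom C D) :
  f =1 g -> f = g.
Proof.
case: f g => [f fS fI] [g gS gI] /= /funext fg.
by case: _ / fg in gS gI *; congr CompleteHom; exact: Prop_irrelevance.
Qed.

Definition complete_id (C : complete_lattice) : complete_hom C C.
Proof. by exists id => A; rewrite image_id. Defined.

Definition complete_comp (C D E : complete_lattice) (g : complete_hom D E)
  (f : complete_hom C D) : complete_hom C E.
Proof.
by exists (g \o f) => A /=; rewrite ?(chom_sup, chom_inf) -image_comp.
Defined.

Definition CLat : category.
Proof.
refine (@Category complete_lattice complete_hom complete_id
  (fun _ _ _ g f => complete_comp g f) _ _ _);
  by move=> *; exact: complete_hom_eq.
Defined.

Section CompleteTheory.
Variable C : complete_lattice.
Implicit Types (A : set C) (x : C).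

Lemma le_sup A x : A x -> x <= sup A.
Proof. by case: (supP A) => + _ => /[apply]. Qed.

Lemma sup_le A x : (forall y, A y -> y <= x) -> sup A <= x.
Proof. by case: (supP A) => _ + Ax; apply=> y; exact: Ax. Qed.

Lemma inf_le A x : A x -> inf A <= x.
Proof. by case: (infP A) => + _ => /[apply]. Qed.

Lemma le_inf A x : (forall y, A y -> x <= y) -> x <= inf A.
Proof. by case: (infP A) => _ + Ax; apply=> y; exact: Ax. Qed.

End CompleteTheory.

Record canonical_extension (L : tbDistrLatticeType lattice_display) := CanExt {
  ce_lattice :> complete_lattice;
  ce_emb : lattice_hom L ce_lattice;
  ce_inj : injective ce_emb;
  ce_join_of_meets : forall u : ce_lattice, exists F : set (set L),
    u = sup [set inf (ce_emb @` S) | S in F];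
  ce_meet_of_joins : forall u : ce_lattice, exists F : set (set L),
    u = inf [set sup (ce_emb @` S) | S in F];
  ce_compact : forall S T : set L,
    inf (ce_emb @` S) <= sup (ce_emb @` T) ->
    exists S' T' : set L, [/\ finite_set S', S' `<=` S, finite_set T',
      T' `<=` T & inf (ce_emb @` S') <= sup (ce_emb @` T')]
}.
Arguments ce_emb {L} c.

Record prime_filter d (L : tbDistrLatticeType d) (P : set L) : Prop :=
  PrimeFilter {
    pf1 : P \top;
    pfI : forall a b, P a -> P b -> P (a `&` b)%O;
    pf_le : forall a b, a <= b -> P a -> P b;
    pf0 : ~ P \bot;
    pfU : forall a b, P (a `|` b)%O -> P a \/ P b
  }.

Section PrimeFilterTheorem.
Context d (L : tbDistrLatticeType d).

Lemma pf_meet (P : set L) (s : seq L) : prime_filter P ->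
  (forall a, a \in s -> P a) -> P (\meet_(a <- s) a).
Proof.
move=> Ppf; elim: s => [|a s IH] sP; first by rewrite big_nil; exact: pf1 Ppf.
rewrite big_cons; apply: (pfI Ppf); first by apply: sP; rewrite mem_head.
by apply: IH => b bs; apply: sP; rewrite in_cons bs orbT.
Qed.

Lemma pf_join (P : set L) (t : seq L) : prime_filter P ->
  P (\join_(a <- t) a) -> exists2 a, a \in t & P a.
Proof.
move=> Ppf; elim: t => [|a t IH]; first by rewrite big_nil => /(pf0 Ppf).
rewrite big_cons => /(pfU Ppf)[Pa|/IH[b bt Pb]].
  by exists a; rewrite // mem_head.
by exists b; rewrite // in_cons bt orbT.
Qed.

Theorem prime_filter_separation (S T : set L) :
  (forall s t : seq L, (forall a, a \in s -> S a) ->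
     (forall a, a \in t -> T a) -> ~ \meet_(a <- s) a <= \join_(a <- t) a) ->
  exists P : set L, [/\ prime_filter P, S `<=` P & forall a, T a -> ~ P a].
Proof.
move=> ST.
pose Q (A : set L) := forall s t : seq L,
  (forall a, a \in s -> A a \/ S a) -> (forall a, a \in t -> T a) ->
  ~ \meet_(a <- s) a <= \join_(a <- t) a.
have [|A [QA Amax]] := @Zorn_bigcup L Q.
  move=> F FQ Ftot s t sF tT.
  have [[X [FX sX]]|sS] :
      (exists X, F X /\ forall a, a \in s -> X a \/ S a) \/
      (forall a, a \in s -> S a).
  - elim: s sF => [|a s IH] sF; first by right.
    have {}IH := IH (fun b bs => sF b (@mem_behead _ (a :: s) b bs)).
    have [|[X FX Xa]|Sa] := sF a; first exact: mem_head.
    + case: IH => [[Y [FY sY]]|sS].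
      * have [XY|YX] := Ftot _ _ FX FY; left.
          exists Y; split=> // b; rewrite in_cons => /predU1P[->|/sY//].
          by left; exact: XY.
        exists X; split=> // b; rewrite in_cons => /predU1P[->|/sY[]]; auto.
      * left; exists X; split=> // b; rewrite in_cons => /predU1P[->|/sS]; auto.
    + case: IH => [[Y [FY sY]]|sS]; [left|right].
      * by exists Y; split=> // b; rewrite in_cons => /predU1P[->|/sY]; auto.
      * by move=> b; rewrite in_cons => /predU1P[->|/sS].
  - exact: FQ FX _ _ sX tT.
  - exact: ST sS tT.
have SA : S `<=` A.
  move=> a Sa; apply: contrapT => nAa; apply: (Amax (A `|` S)%classic).
    by split; [move=> b; left|move=> /(_ a (or_intror Sa))].
  move=> s t sAS; apply: QA => b /sAS[]; last by right.
  by case; [left|right].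
have notA a : ~ A a -> exists s t : seq L,
    [/\ forall b, b \in s -> A b, forall b, b \in t -> T b &
    (\meet_(b <- s) b) `&` a <= \join_(b <- t) b].
  move=> nAa; apply: contrapT => H; apply: (Amax (a |` A)).
    by split; [move=> b; right|move=> /(_ a (or_introl erefl))].
  move=> s t sA tT st; apply: H; exists [seq b <- s | b != a], t; split=> //.
    move=> b; rewrite mem_filter => /andP[/eqP ba /sA[[/ba//|//]|/SA//]].
  apply: le_trans st; rewrite -[X in _ <= X]/(\meet_(b <- s) b).
  elim: s {sA} => [|b s IH] /=; first by rewrite !big_nil lex1.
  rewrite big_cons lexI; case: eqVneq => [->|ba] /=.
    by rewrite leIr IH.
  rewrite big_cons -meetA; apply/andP; split; first exact: leIl.
  by apply: le_trans IH; exact: leIr.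
have in_A s a : (forall b, b \in s -> A b) -> \meet_(b <- s) b <= a -> A a.
  move=> sA sa; apply: contrapT => /notA[s' [t [s'A tT]]] H.
  apply: (QA (s' ++ s) t) => //.
    by move=> b; rewrite mem_cat => /orP[/s'A|/sA]; left.
  by rewrite big_cat /=; apply: le_trans H; rewrite leI2.
exists A; split=> //.
- split.
  + by apply: (in_A [::]); rewrite ?big_nil.
  + move=> a b Aa Ab; apply: (in_A [:: a; b]).
      by move=> c; rewrite !inE => /orP[] /eqP->.
    by rewrite !big_cons big_nil meetx1.
  + move=> a b ab Aa; apply: (in_A [:: a]); last by rewrite big_seq1.
    by move=> c; rewrite inE => /eqP->.
  + move=> A0; apply: (QA [:: \bot] [::]) => //.
      by move=> a; rewrite inE => /eqP->; left.
    by rewrite big_seq1 big_nil.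
  + move=> a b Aab; apply: contrapT => /not_orP[].
    move=> /notA[s [t [sA tT st]]] /notA[s' [t' [s'A t'T st']]].
    apply: (QA ((a `|` b)%O :: s ++ s') (t ++ t')).
    * move=> c; rewrite in_cons mem_cat.
      by move=> /predU1P[->|/orP[/sA|/s'A]]; left.
    * by move=> c; rewrite mem_cat => /orP[/tT|/t'T].
    rewrite big_cons !big_cat /= meetUl leUx; apply/andP; split.
      apply: le_trans (leUl _ _); apply: le_trans st.
      by rewrite lexI leIl andbT; apply: le_trans (leIr _ _) (leIl _ _).
    apply: le_trans (leUr _ _); apply: le_trans st'.
    by rewrite lexI leIl andbT; apply: le_trans (leIr _ _) (leIr _ _).
- move=> a Ta Aa; apply: (QA [:: a] [:: a]); rewrite ?big_seq1 //.
    by move=> b; rewrite inE => /eqP->; left.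
  by move=> b; rewrite inE => /eqP->.
Qed.

End PrimeFilterTheorem.

(* The canonical extension is realised as the lattice of up-closed sets of    *)
(* prime filters; [can_ext_unique] shows that the choice is immaterial.       *)
Record pfilter d (L : tbDistrLatticeType d) := PFilter {
  pf_set :> set L;
  pf_prime : prime_filter pf_set
}.

Definition pf_mem d (L : tbDistrLatticeType d) (P : pfilter L) : L -> Prop :=
  pf_set P.
Coercion pf_mem : pfilter >-> Funclass.
Arguments pf_mem _ _ _ _ /.

Lemma pfilter_eq d (L : tbDistrLatticeType d) (P Q : pfilter L) :
  P = Q :> set L -> P = Q.
Proof.
case: P Q => [P Ppf] [Q Qpf] /= PQ.
by case: _ / PQ in Qpf *; congr PFilter; exact: Prop_irrelevance.
Qed.

Record upset d (L : tbDistrLatticeType d) := Upset {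
  up_set :> set (pfilter L);
  upP : forall P Q : pfilter L, P `<=` Q -> up_set P -> up_set Q
}.

Definition up_mem d (L : tbDistrLatticeType d) (u : upset L) :
  pfilter L -> Prop := up_set u.
Coercion up_mem : upset >-> Funclass.
Arguments up_mem _ _ _ _ /.

Section UpsetLattice.
Context d (L : tbDistrLatticeType d).
Local Notation U := (upset L).

Lemma upset_eq (u v : U) : (forall P, u P <-> v P) -> u = v.
Proof.
case: u v => [u uP] [v vP] /= uv.
have {}uv : u = v by apply/seteqP; split=> P /uv.
by case: _ / uv in vP *; congr Upset; exact: Prop_irrelevance.
Qed.

HB.instance Definition _ := gen_eqMixin U.
HB.instance Definition _ := gen_choiceMixin U.

Definition upset_sup (A : set U) : U.
Proof.
exists [set P | exists2 u, A u & u P] => P Q PQ [u Au uP].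
by exists u => //; exact: upP PQ uP.
Defined.

Definition upset_inf (A : set U) : U.
Proof.
by exists [set P | forall u, A u -> u P] => P Q PQ AP u /AP; exact: upP.
Defined.

Definition upset_meet (u v : U) : U.
Proof.
exists [set P | u P /\ v P] => P Q PQ [uP vP].
by split; [exact: (upP PQ uP)|exact: (upP PQ vP)].
Defined.

Definition upset_join (u v : U) : U.
Proof.
exists [set P | u P \/ v P] => P Q PQ [uP|vP].
  by left; exact: (upP PQ uP).
by right; exact: (upP PQ vP).
Defined.

Definition upset_le (u v : U) : bool := `[< u `<=` v >].
Definition upset_lt (u v : U) : bool := (v != u) && upset_le u v.

Fact upset_le_def u v : upset_le u v = (upset_meet u v == u).
Proof.
apply/asboolP/eqP => [uv|<- P /=[]//].
by apply: upset_eq => P /=; split=> [[]//|uP]; split=> //; exact: uv.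
Qed.

Fact upset_lt_def u v : upset_lt u v = (v != u) && upset_le u v.
Proof. by []. Qed.

Fact upset_meetC : commutative upset_meet.
Proof. by move=> u v; apply: upset_eq => P /=; tauto. Qed.
Fact upset_joinC : commutative upset_join.
Proof. by move=> u v; apply: upset_eq => P /=; tauto. Qed.
Fact upset_meetA : associative upset_meet.
Proof. by move=> u v w; apply: upset_eq => P /=; tauto. Qed.
Fact upset_joinA : associative upset_join.
Proof. by move=> u v w; apply: upset_eq => P /=; tauto. Qed.
Fact upset_joinKI v u : upset_meet u (upset_join u v) = u.
Proof. by apply: upset_eq => P /=; tauto. Qed.
Fact upset_meetKU v u : upset_join u (upset_meet u v) = u.
Proof. by apply: upset_eq => P /=; tauto. Qed.
Fact upset_meetUl : left_distributive upset_meet upset_join.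
Proof. by move=> u v w; apply: upset_eq => P /=; tauto. Qed.
Fact upset_meetxx : idempotent_op upset_meet.
Proof. by move=> u; apply: upset_eq => P /=; tauto. Qed.

HB.instance Definition _ :=
  Order.isMeetJoinDistrLattice.Build lattice_display U
    upset_le_def upset_lt_def upset_meetC upset_joinC upset_meetA upset_joinA
    upset_joinKI upset_meetKU upset_meetUl upset_meetxx.

Lemma upset_leP (u v : U) : reflect (u `<=` v) (u <= v).
Proof. exact: asboolP. Qed.

Fact upset_le0 u : upset_sup set0 <= u.
Proof. by apply/upset_leP => P []. Qed.
Fact upset_le1 u : u <= upset_inf set0.
Proof. by apply/upset_leP => P _ v []. Qed.

HB.instance Definition _ := Order.hasBottom.Build lattice_display U upset_le0.
HB.instance Definition _ := Order.hasTop.Build lattice_display U upset_le1.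

Fact upset_supP A : supremums A (upset_sup A).
Proof.
split=> [u Au|v Av]; apply/upset_leP => P /=; first by exists u.
by case=> u /Av/upset_leP; apply.
Qed.

Fact upset_infP A : infimums A (upset_inf A).
Proof.
split=> [u Au|v Av]; apply/upset_leP => P /=; first exact.
by move=> vP u /Av/upset_leP; apply.
Qed.

Definition upset_lattice : complete_lattice :=
  CompleteLattice upset_supP upset_infP.

Definition principal_upset (a : L) : U.
Proof. by exists [set P : pfilter L | P a] => P Q; apply. Defined.

Fact principal_upsetI : Order.meet_morphism principal_upset.
Proof.
move=> a b; apply: upset_eq => P /=.
split=> [Pab|[]]; last exact: (pfI (pf_prime P)).
by split; apply: (pf_le (pf_prime P) _ Pab); [exact: leIl|exact: leIr].
Qed.

Fact principal_upsetU : Order.join_morphism principal_upset.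
Proof.
move=> a b; apply: upset_eq => P /=; split; first exact: (pfU (pf_prime P)).
by case; apply: (pf_le (pf_prime P) _); [exact: leUl|exact: leUr].
Qed.

Fact principal_upset0 : principal_upset \bot = \bot.
Proof. by apply: upset_eq => P /=; split=> [/(pf0 (pf_prime P))|[]]. Qed.

Fact principal_upset1 : principal_upset \top = \top.
Proof. by apply: upset_eq => P /=; split=> // _; exact: (pf1 (pf_prime P)). Qed.

End UpsetLattice.

Section CanonicalExtension.
Variable L : tbDistrLatticeType lattice_display.

Definition upset_emb : lattice_hom L (upset_lattice L) :=
  @LatticeHom _ _ L (upset_lattice L) (@principal_upset _ L)
    (@principal_upsetI _ L) (@principal_upsetU _ L)
    (@principal_upset0 _ L) (@principal_upset1 _ L).

Lemma upset_inf_emb (S : set L) (P : pfilter L) :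
  (inf (upset_emb @` S) : upset L) P <-> S `<=` P.
Proof.
split=> [H a Sa|SP _ [a Sa <-]]; last exact: SP.
by apply: (H (upset_emb a)); exists a.
Qed.

Lemma upset_sup_emb (S : set L) (P : pfilter L) :
  (sup (upset_emb @` S) : upset L) P <-> exists2 a, S a & P a.
Proof.
split=> [[_ [a Sa <-] Pa]|[a Sa Pa]]; first by exists a.
by exists (upset_emb a) => //; exists a.
Qed.

Lemma upset_emb_inj : injective upset_emb.
Proof.
suff H a b : upset_emb a = upset_emb b -> a <= b.
  by move=> a b ab; apply/le_anti/andP; split; apply: H.
move=> ab; apply: contrapT => nab.
have [|P [Ppf aP bP]] := @prime_filter_separation _ L [set a] [set b].
  move=> s t sa tb st; apply: nab; apply: (le_trans (y := \meet_(c <- s) c)).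
    by elim: s sa {st} => [|c s IH] sa; rewrite ?big_nil ?lex1 // big_cons lexI;
      rewrite (sa c (mem_head _ _)) lexx IH // => x xs; apply: sa;
      rewrite in_cons xs orbT.
  apply: (le_trans st).
  by elim: t tb {st} => [|c s' IH] tb; rewrite ?big_nil ?le0x // big_cons leUx;
    rewrite (tb c (mem_head _ _)) lexx IH // => x xs; apply: tb;
    rewrite in_cons xs orbT.
apply: (bP b erefl); have : (upset_emb a : upset L) (PFilter Ppf) by exact: aP.
by rewrite ab.
Qed.

Lemma upset_join_of_meets (u : upset_lattice L) : exists F : set (set L),
  u = sup [set inf (upset_emb @` S) | S in F].
Proof.
exists [set S | exists2 P : pfilter L, (u : upset L) P & S = pf_set P].
apply: upset_eq => P; split=> [uP|[_ [_ [Q uQ ->] <-] /upset_inf_emb QP]].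
  exists (inf (upset_emb @` (pf_set P))); last exact/upset_inf_emb.
  by exists (pf_set P) => //; exists P.
exact: upP QP uQ.
Qed.

Lemma upset_meet_of_joins (u : upset_lattice L) : exists F : set (set L),
  u = inf [set sup (upset_emb @` S) | S in F].
Proof.
exists [set S | exists2 P : pfilter L, ~ (u : upset L) P & S = ~` pf_set P].
apply: upset_eq => P; split=> [uP _ [_ [Q nuQ ->] <-]|H].
  apply/upset_sup_emb; apply: contrapT => nPQ; apply: nuQ.
  apply: upP uP => a Pa; apply: contrapT => nQa; apply: nPQ; by exists a.
apply: contrapT => nuP.
suff /upset_sup_emb[a nPa Pa] :
  (sup (upset_emb @` (~` pf_set P)) : upset L) P by exact: nPa.
by apply: H; exists (~` pf_set P) => //; exists P.
Qed.

Lemma upset_compact (S T : set L) :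
  inf (upset_emb @` S) <= sup (upset_emb @` T) ->
  exists S' T' : set L, [/\ finite_set S', S' `<=` S, finite_set T',
    T' `<=` T & inf (upset_emb @` S') <= sup (upset_emb @` T')].
Proof.
move=> ST; apply: contrapT => H.
have [|P [Ppf SP TP]] := @prime_filter_separation _ L S T.
  move=> s t sS tT st; apply: H; exists [set` s], [set` t].
  split; [exact: finite_seq|by move=> a /sS|exact: finite_seq|by move=> a /tT|].
  apply/upset_leP => P /upset_inf_emb sP; apply/upset_sup_emb.
  have [|a] := @pf_join _ L P t (pf_prime P); last by exists a.
  by apply: (pf_le (pf_prime P) st _); apply: (pf_meet (pf_prime P)) => a /sP.
move/upset_leP: ST => /(_ (PFilter Ppf)) H'.
have /upset_sup_emb[a /TP + Pa] :
    (sup (upset_emb @` T) : upset L) (PFilter Ppf).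
  by apply: H'; exact/upset_inf_emb.
by apply.
Qed.

Definition delta : canonical_extension L :=
  CanExt upset_emb_inj upset_join_of_meets upset_meet_of_joins upset_compact.

Lemma ce_le (C : canonical_extension L) a b :
  a <= b -> ce_emb C a <= ce_emb C b.
Proof.
by move=> /meet_idPl ab; apply/meet_idPl; rewrite -lhomI ab.
Qed.

Definition can_ext_fwd (C : canonical_extension L) (u : C) : upset L.
Proof.
exists [set P : pfilter L | inf (ce_emb C @` pf_set P) <= u] => P Q PQ.
apply: le_trans.
apply: le_inf => _ [a Pa <-]; apply: inf_le; exists a => //; exact: PQ.
Defined.

Definition can_ext_bwd (C : canonical_extension L) (u : upset L) : C :=
  sup [set inf (ce_emb C @` (pf_set P)) | P in (u : set (pfilter L))].

Lemma can_ext_separation (C : canonical_extension L) (S T : set L) :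
  ~ inf (ce_emb C @` S) <= sup (ce_emb C @` T) ->
  exists P : pfilter L, S `<=` P /\ forall a, T a -> ~ P a.
Proof.
move=> nST; have [|P [Ppf SP TP]] := @prime_filter_separation _ L S T.
  move=> s t sS tT st; apply: nST.
  apply: (le_trans (y := ce_emb C (\meet_(a <- s) a))).
    elim: s sS {st} => [|a s IH] sS; first by rewrite big_nil lhom1 lex1.
    rewrite big_cons lhomI lexI IH ?andbT; last first.
      by move=> b bs; apply: sS; rewrite in_cons bs orbT.
    by apply: inf_le; exists a => //; apply: sS; rewrite mem_head.
  apply: (le_trans (ce_le C st)).
  elim: t tT {st} => [|a t IH] tT; first by rewrite big_nil lhom0 le0x.
  rewrite big_cons lhomU leUx IH ?andbT; last first.
    by move=> b bs; apply: tT; rewrite in_cons bs orbT.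
  by apply: le_sup; exists a => //; apply: tT; rewrite mem_head.
by exists (PFilter Ppf).
Qed.

Lemma can_ext_prime (C : canonical_extension L) (P : pfilter L) (T : set L) :
  inf (ce_emb C @` pf_set P) <= sup (ce_emb C @` T) -> exists2 a, T a & P a.
Proof.
move=> /ce_compact[S' [T' [/finite_seqP[s ->] sP /finite_seqP[t ->] tT]]] st.
suff : \meet_(a <- s) a <= \join_(a <- t) a.
  move=> /(pf_le (pf_prime P)) /(_ (pf_meet (pf_prime P) sP)).
  by move=> /(pf_join (pf_prime P))[a /tT ? ?]; exists a.
suff : ce_emb C (\meet_(a <- s) a) <= ce_emb C (\join_(a <- t) a).
  by move=> /meet_idPl; rewrite -lhomI => /ce_inj/meet_idPl.
apply: (le_trans (y := inf (ce_emb C @` [set` s]))).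
  apply: le_inf => _ [a /= + <-]; elim: s {sP st} => // b s IH.
  rewrite in_cons big_cons lhomI => /predU1P[->|/IH]; first exact: leIl.
  by apply: le_trans; exact: leIr.
apply: (le_trans st); apply: sup_le => _ [a /= + <-].
elim: t {tT st} => // b t IH; rewrite in_cons big_cons lhomU.
move=> /predU1P[->|/IH]; first exact: leUl.
by move/le_trans; apply; exact: leUr.
Qed.

Lemma can_ext_fwd_le (C : canonical_extension L) (u v : C) :
  (can_ext_fwd u <= can_ext_fwd v) = (u <= v).
Proof.
apply/upset_leP/idP => [uv|uv P /= /le_trans]; last exact.
have [F uE] := ce_join_of_meets u; have [G vE] := ce_meet_of_joins v.
rewrite uE vE; apply: sup_le => _ [S FS <-]; apply: le_inf => _ [T GT <-].
have Su : inf (ce_emb C @` S) <= u by rewrite uE; apply: le_sup; exists S.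
have vT : v <= sup (ce_emb C @` T) by rewrite vE; apply: inf_le; exists T.
apply: contrapT => /can_ext_separation[P [SP TP]].
have Pu : can_ext_fwd u P.
  apply: le_trans Su; apply: le_inf => _ [a Sa <-]; apply: inf_le.
  by exists a => //; exact: SP.
have [a /TP] := can_ext_prime (le_trans (uv P Pu) vT); exact.
Qed.

Lemma can_ext_bwdK (C : canonical_extension L) :
  cancel (@can_ext_bwd C) (@can_ext_fwd C).
Proof.
move=> u; apply: upset_eq => Q; split=> /= [|uQ]; last first.
  by apply: le_sup; exists Q.
move=> QS; apply: contrapT => nuQ.
have [|a /= nQa Qa] := @can_ext_prime C Q (~` pf_set Q); last exact: nQa.
apply: (le_trans QS); apply: sup_le => _ [P uP <-].
have [a Pa nQa] : exists2 a, P a & ~ Q a.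
  apply: contrapT => H; apply: nuQ; apply: upP uP => a Pa.
  by apply: contrapT => nQa; apply: H; exists a.
apply: (le_trans (y := ce_emb C a)); first by apply: inf_le; exists a.
by apply: le_sup; exists a.
Qed.

Lemma can_ext_fwdK (C : canonical_extension L) :
  cancel (@can_ext_fwd C) (@can_ext_bwd C).
Proof.
move=> u; apply/le_anti; rewrite -!can_ext_fwd_le !can_ext_bwdK.
by rewrite lexx.
Qed.

End CanonicalExtension.

Lemma order_iso_complete (C D : complete_lattice) (f : C -> D) (g : D -> C) :
  cancel f g -> cancel g f -> (forall x y, (f x <= f y) = (x <= y)) ->
  exists h : complete_hom C D, f = h.
Proof.
move=> fK gK fle; unshelve eexists (@CompleteHom C D f _ _) => //.
- move=> A; apply/le_anti/andP; split.
    rewrite -[X in _ <= X]gK fle; apply: sup_le => x Ax.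
    by rewrite -fle gK; apply: le_sup; exists x.
  by apply: sup_le => _ [x Ax <-]; rewrite fle; exact: le_sup.
- move=> A; apply/le_anti/andP; split.
    by apply: le_inf => _ [x Ax <-]; rewrite fle; exact: inf_le.
  rewrite -[X in X <= _]gK fle; apply: le_inf => x Ax.
  by rewrite -fle gK; apply: inf_le; exists x.
Qed.

Theorem can_ext_unique (L : tbDistrLatticeType lattice_display)
    (C : canonical_extension L) :
  exists (f : complete_hom (delta L) C) (g : complete_hom C (delta L)),
    [/\ cancel f g, cancel g f & forall a, f (ce_emb (delta L) a) = ce_emb C a].
Proof.
have bwd_le u v : (@can_ext_bwd L C u <= can_ext_bwd C v) = (u <= v).
  by rewrite -can_ext_fwd_le !can_ext_bwdK.
have [f fE] := @order_iso_complete (delta L) C _ _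
  (@can_ext_bwdK L C) (@can_ext_fwdK L C) bwd_le.
have [g gE] := @order_iso_complete C (delta L) _ _
  (@can_ext_fwdK L C) (@can_ext_bwdK L C) (@can_ext_fwd_le L C).
exists f, g; rewrite -fE -gE; split; [exact: can_ext_bwdK|exact: can_ext_fwdK|].
move=> a; rewrite -[RHS]can_ext_fwdK; congr can_ext_bwd.
apply: upset_eq => P /=; split=> [Pa|]; first by apply: inf_le; exists a.
have -> : ce_emb C a = sup (ce_emb C @` [set a]).
  apply/le_anti/andP; split; first by apply: le_sup; exists a.
  by apply: sup_le => _ [_ -> <-].
by move=> /can_ext_prime[_ ->].
Qed.

Section DeltaMap.
Context (L K : tbDistrLatticeType lattice_display) (f : lattice_hom L K).

Lemma pfilter_preimage_prime (Q : pfilter K) : prime_filter (f @^-1` Q).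
Proof.
have Qpf := pf_prime Q; split=> /=.
- by rewrite lhom1; exact: (pf1 Qpf).
- by move=> a b Qa Qb; rewrite /= lhomI; exact: (pfI Qpf).
- move=> a b ab; apply: (pf_le Qpf).
  by move/meet_idPl: ab => ab; apply/meet_idPl; rewrite -lhomI ab.
- by rewrite lhom0; exact: (pf0 Qpf).
- by move=> a b; rewrite /= lhomU; exact: (pfU Qpf).
Qed.

Definition pfilter_preimage (Q : pfilter K) : pfilter L :=
  PFilter (pfilter_preimage_prime Q).

Definition upset_map (u : upset L) : upset K.
Proof.
exists [set Q | u (pfilter_preimage Q)] => P Q PQ.
by apply: upP => a; exact: PQ.
Defined.

Lemma upset_map_sup (A : set (delta L)) :
  upset_map (sup A) = @sup (delta K) (upset_map @` A).
Proof.
apply: upset_eq => P; split=> [[u Au uP]|[_ [u Au <-] uP]]; last by exists u.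
by exists (upset_map u) => //; exists u.
Qed.

Lemma upset_map_inf (A : set (delta L)) :
  upset_map (inf A) = @inf (delta K) (upset_map @` A).
Proof.
apply: upset_eq => P; split=> [H _ [u Au <-]|H u Au]; first exact: (H u).
by apply: (H (upset_map u)); exists u.
Qed.

Definition delta_map : complete_hom (delta L) (delta K) :=
  @CompleteHom (delta L) (delta K) upset_map upset_map_sup upset_map_inf.

Lemma delta_mapE a : delta_map (ce_emb (delta L) a) = ce_emb (delta K) (f a).
Proof. exact: upset_eq. Qed.

Lemma delta_map_unique (g : complete_hom (delta L) (delta K)) :
  (forall a, g (ce_emb (delta L) a) = ce_emb (delta K) (f a)) -> g = delta_map.
Proof.
move=> gE; apply: complete_hom_eq => u.
have gI S : g (inf (ce_emb (delta L) @` S)) =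
            delta_map (inf (ce_emb (delta L) @` S)).
  rewrite !chom_inf !image_comp; congr (inf _); apply: eq_imagel => a _.
  exact: etrans (gE a) (esym (delta_mapE a)).
have [F ->] := ce_join_of_meets u; rewrite !chom_sup !image_comp.
by congr (sup _); apply: eq_imagel => S _; exact: gI.
Qed.

End DeltaMap.

Definition delta_functor : functor DL CLat.
Proof.
refine (@Functor DL CLat (fun L => delta L) (fun L K f => delta_map f) _ _).
- by move=> L; apply/esym/delta_map_unique.
- by move=> L K H g f; apply/esym/delta_map_unique => a.
Defined.

Record signature := Signature {
  rel_symbol :> Type;
  arity : rel_symbol -> nat
}.

(* [formula S X] is the type of coherent formulae with free variables in [X]; *)
(* in [Ex phi] the bound variable of [phi] is [None].                         *)
Inductive formula (S : signature) (X : Type) : Type :=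
| Atom (R : S) of ('I_(arity R) -> X)
| Equal of X & X
| Top
| Bot
| And of formula S X & formula S X
| Or of formula S X & formula S X
| Ex of formula S (option X).
Arguments Atom {S X}.
Arguments Equal {S X}.
Arguments Top {S X}.
Arguments Bot {S X}.

Fixpoint subst (S : signature) (X Y : Type) (f : X -> Y) (phi : formula S X) :
    formula S Y :=
  match phi with
  | Atom R x => Atom R (f \o x)
  | Equal x y => Equal (f x) (f y)
  | Top => Top
  | Bot => Bot
  | And phi psi => And (subst f phi) (subst f psi)
  | Or phi psi => Or (subst f phi) (subst f psi)
  | Ex phi => Ex (subst (omap f) phi)
  end.

Record sequent (S : signature) := Sequent {
  seq_ctx : nat;
  antecedent : formula S 'I_seq_ctx;
  succedent : formula S 'I_seq_ctx
}.

Definition theory (S : signature) := set (sequent S).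

(* Provability of [phi |- psi] in context [X]. Keeping track of contexts      *)
(* makes the calculus sound for empty structures. Contexts may be infinite,   *)
(* so that parameters from an arbitrary set can be treated as variables; a    *)
(* formula only ever mentions finitely many elements of its context.          *)
Inductive entails (S : signature) (T : theory S) :
  forall X : Type, formula S X -> formula S X -> Prop :=
| ent_axiom s : T s -> entails T (antecedent s) (succedent s)
| ent_subst X Y (f : X -> Y) (phi psi : formula S X) :
    entails T phi psi -> entails T (subst f phi) (subst f psi)
| ent_refl X (phi : formula S X) : entails T phi phi
| ent_trans X (phi psi chi : formula S X) :
    entails T phi psi -> entails T psi chi -> entails T phi chi
| ent_eq_refl X (x : X) : entails T Top (Equal x x)
| ent_eq_subst X (x y : X) (phi : formula S (option X)) :
    entails T (And (Equal x y) (subst (odflt x) phi)) (subst (odflt y) phi)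
| ent_top X (phi : formula S X) : entails T phi Top
| ent_bot X (phi : formula S X) : entails T Bot phi
| ent_andl X (phi psi : formula S X) : entails T (And phi psi) phi
| ent_andr X (phi psi : formula S X) : entails T (And phi psi) psi
| ent_and X (chi phi psi : formula S X) :
    entails T chi phi -> entails T chi psi -> entails T chi (And phi psi)
| ent_orl X (phi psi : formula S X) : entails T phi (Or phi psi)
| ent_orr X (phi psi : formula S X) : entails T psi (Or phi psi)
| ent_or X (phi psi chi : formula S X) :
    entails T phi chi -> entails T psi chi -> entails T (Or phi psi) chi
| ent_distr X (phi psi chi : formula S X) :
    entails T (And phi (Or psi chi)) (Or (And phi psi) (And phi chi))
| ent_exl X (phi : formula S (option X)) (psi : formula S X) :
    entails T phi (subst Some psi) -> entails T (Ex phi) psi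
| ent_exr X (phi : formula S (option X)) (psi : formula S X) :
    entails T (Ex phi) psi -> entails T phi (subst Some psi)
| ent_frobenius X (phi : formula S X) (psi : formula S (option X)) :
    entails T (And phi (Ex psi)) (Ex (And (subst Some phi) psi)).

Section Substitution.
Variable S : signature.

Lemma subst_id X (phi : formula S X) : subst id phi = phi.
Proof.
elim: phi => //= {}X; do ?[by move=> ? -> ? ->].
by move=> phi IH; rewrite (_ : omap id = id) ?IH //; apply/funext => -[].
Qed.

Lemma subst_comp X Y Z (g : Y -> Z) (f : X -> Y) (phi : formula S X) :
  subst g (subst f phi) = subst (g \o f) phi.
Proof.
elim: phi Y Z g f => //= {}X.
- by move=> phi IHphi psi IHpsi Y Z g f; rewrite IHphi IHpsi.
- by move=> phi IHphi psi IHpsi Y Z g f; rewrite IHphi IHpsi.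
- move=> phi IH Y Z g f; rewrite IH; congr (Ex (subst _ _)).
  by apply/funext => -[].
Qed.

End Substitution.

HB.instance Definition _ (S : signature) (X : Type) :=
  gen_eqMixin (formula S X).
HB.instance Definition _ (S : signature) (X : Type) :=
  gen_choiceMixin (formula S X).

Section SyntacticLattice.
Context (S : signature) (T : theory S) (X : Type).
Implicit Types phi psi chi : formula S X.

Definition prov_equiv : rel (formula S X) :=
  fun phi psi => `[< entails T phi psi /\ entails T psi phi >].

Fact prov_equiv_refl : reflexive prov_equiv.
Proof. by move=> phi; apply/asboolP; split; exact: ent_refl. Qed.

Fact prov_equiv_sym : symmetric prov_equiv.
Proof.
by move=> phi psi; apply/asboolP/asboolP => -[].
Qed.

Fact prov_equiv_trans : transitive prov_equiv.
Proof.
move=> psi phi chi /asboolP[ab ba] /asboolP[bc cb].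
by apply/asboolP; split; [exact: ent_trans ab bc|exact: ent_trans cb ba].
Qed.

Canonical prov_equiv_rel :=
  EquivRel prov_equiv prov_equiv_refl prov_equiv_sym prov_equiv_trans.

Definition syn_lattice := {eq_quot prov_equiv}.

HB.instance Definition _ := Choice.on syn_lattice.
HB.instance Definition _ := EqQuotient.on syn_lattice.

Local Notation cl := (\pi_syn_lattice : formula S X -> syn_lattice).

Lemma syn_eqP phi psi :
  cl phi = cl psi <-> entails T phi psi /\ entails T psi phi.
Proof.
split=> [/eqP|H]; first by rewrite piE => /asboolP.
by apply/eqP; rewrite piE; exact/asboolP.
Qed.

Lemma repr_entails phi :
  entails T (repr (cl phi)) phi /\ entails T phi (repr (cl phi)).
Proof. by apply/syn_eqP; rewrite reprK. Qed.

Definition syn_le (a b : syn_lattice) : bool :=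
  `[< entails T (repr a) (repr b) >].
Definition syn_lt (a b : syn_lattice) : bool := (b != a) && syn_le a b.
Definition syn_meet (a b : syn_lattice) : syn_lattice :=
  cl (And (repr a) (repr b)).
Definition syn_join (a b : syn_lattice) : syn_lattice :=
  cl (Or (repr a) (repr b)).
Definition syn_bot : syn_lattice := cl Bot.
Definition syn_top : syn_lattice := cl Top.

Lemma syn_le_pi phi psi : syn_le (cl phi) (cl psi) <-> entails T phi psi.
Proof.
have [a b] := repr_entails phi; have [c d] := repr_entails psi.
split=> [/asboolP H|H].
  exact: ent_trans b (ent_trans H c).
by apply/asboolP; exact: ent_trans a (ent_trans H d).
Qed.

Lemma and_mono phi phi' psi psi' : entails T phi phi' -> entails T psi psi' ->
  entails T (And phi psi) (And phi' psi').
Proof.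
move=> p q; apply: ent_and.
  exact: ent_trans (ent_andl _ _ _) p.
exact: ent_trans (ent_andr _ _ _) q.
Qed.

Lemma or_mono phi phi' psi psi' : entails T phi phi' -> entails T psi psi' ->
  entails T (Or phi psi) (Or phi' psi').
Proof.
move=> p q; apply: ent_or.
  exact: ent_trans p (ent_orl _ _ _).
exact: ent_trans q (ent_orr _ _ _).
Qed.

Lemma syn_meet_pi phi psi : syn_meet (cl phi) (cl psi) = cl (And phi psi).
Proof.
by apply/syn_eqP; split; apply: and_mono; have [] := repr_entails phi;
  have [] := repr_entails psi.
Qed.

Lemma syn_join_pi phi psi : syn_join (cl phi) (cl psi) = cl (Or phi psi).
Proof.
by apply/syn_eqP; split; apply: or_mono; have [] := repr_entails phi;
  have [] := repr_entails psi.
Qed.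

Lemma syn_ind (P : syn_lattice -> Prop) : (forall phi, P (cl phi)) ->
  forall a, P a.
Proof. by move=> H a; rewrite -[a]reprK; exact: H. Qed.

#[local] Hint Resolve ent_refl ent_top ent_bot ent_andl ent_andr ent_orl
  ent_orr ent_distr : core.
#[local] Hint Resolve ent_and ent_or : core.

Fact syn_le_def a b : syn_le a b = (syn_meet a b == a).
Proof.
elim/syn_ind: a => phi; elim/syn_ind: b => psi.
rewrite syn_meet_pi; apply/idP/eqP => [/syn_le_pi H|/syn_eqP[_ H]].
  by apply/syn_eqP; split; auto.
by apply/syn_le_pi; apply: ent_trans H _.
Qed.

Fact syn_lt_def a b : syn_lt a b = (b != a) && syn_le a b.
Proof. by []. Qed.

Fact syn_meetC : commutative syn_meet.
Proof.
elim/syn_ind=> phi; elim/syn_ind=> psi; rewrite !syn_meet_pi.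
by apply/syn_eqP; split; auto.
Qed.

Fact syn_joinC : commutative syn_join.
Proof.
elim/syn_ind=> phi; elim/syn_ind=> psi; rewrite !syn_join_pi.
by apply/syn_eqP; split; auto.
Qed.

Fact syn_meetA : associative syn_meet.
Proof.
elim/syn_ind=> phi; elim/syn_ind=> psi; elim/syn_ind=> chi.
rewrite !syn_meet_pi; apply/syn_eqP; split; apply: ent_and.
- by apply: and_mono.
- by apply: ent_trans (ent_andr _ _ _) _.
- by apply: ent_trans (ent_andl _ _ _) _.
- by apply: and_mono.
Qed.

Fact syn_joinA : associative syn_join.
Proof.
elim/syn_ind=> phi; elim/syn_ind=> psi; elim/syn_ind=> chi.
rewrite !syn_join_pi; apply/syn_eqP; split; apply: ent_or.
- by apply: ent_trans (ent_orl _ _ _).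
- by apply: or_mono.
- by apply: or_mono.
- by apply: ent_trans (ent_orr _ _ _).
Qed.

Fact syn_joinKI b a : syn_meet a (syn_join a b) = a.
Proof.
elim/syn_ind: a => phi; elim/syn_ind: b => psi.
by rewrite syn_join_pi syn_meet_pi; apply/syn_eqP; split; auto.
Qed.

Fact syn_meetKU b a : syn_join a (syn_meet a b) = a.
Proof.
elim/syn_ind: a => phi; elim/syn_ind: b => psi.
by rewrite syn_meet_pi syn_join_pi; apply/syn_eqP; split; auto.
Qed.

Fact syn_meetUl : left_distributive syn_meet syn_join.
Proof.
elim/syn_ind=> phi; elim/syn_ind=> psi; elim/syn_ind=> chi.
rewrite !(syn_meet_pi, syn_join_pi); apply/syn_eqP; split.
  apply: (@ent_trans _ _ _ _ (And chi (Or phi psi))); first by auto.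
  by apply: ent_trans (ent_distr _ _ _ _) _; apply: or_mono; auto.
by apply: ent_or; apply: and_mono; auto.
Qed.

Fact syn_meetxx : idempotent_op syn_meet.
Proof.
by elim/syn_ind=> phi; rewrite syn_meet_pi; apply/syn_eqP; split; auto.
Qed.

HB.instance Definition _ :=
  Order.isMeetJoinDistrLattice.Build lattice_display syn_lattice
    syn_le_def syn_lt_def syn_meetC syn_joinC syn_meetA syn_joinA
    syn_joinKI syn_meetKU syn_meetUl syn_meetxx.

Fact syn_le0 a : syn_bot <= a.
Proof. by elim/syn_ind: a => phi; apply/syn_le_pi. Qed.

Fact syn_le1 a : a <= syn_top.
Proof. by elim/syn_ind: a => phi; apply/syn_le_pi. Qed.

HB.instance Definition _ :=
  Order.hasBottom.Build lattice_display syn_lattice syn_le0.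
HB.instance Definition _ :=
  Order.hasTop.Build lattice_display syn_lattice syn_le1.

Lemma syn_leE phi psi : cl phi <= cl psi <-> entails T phi psi.
Proof. exact: syn_le_pi. Qed.

Lemma syn_meetE phi psi : (cl phi `&` cl psi)%O = cl (And phi psi).
Proof. exact: syn_meet_pi. Qed.

Lemma syn_joinE phi psi : (cl phi `|` cl psi)%O = cl (Or phi psi).
Proof. exact: syn_join_pi. Qed.

End SyntacticLattice.

Section SyntacticMap.
Context (S : signature) (T : theory S) (X Y : Type) (f : X -> Y).

Definition syn_map (a : syn_lattice T X) : syn_lattice T Y :=
  \pi_(syn_lattice T Y) (subst f (repr a)).

Lemma syn_map_pi phi : syn_map (\pi_(syn_lattice T X) phi) =
  \pi_(syn_lattice T Y) (subst f phi).
Proof.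
by apply/syn_eqP; have [] := repr_entails T phi; split; exact: ent_subst.
Qed.

Fact syn_mapI : Order.meet_morphism syn_map.
Proof.
elim/syn_ind=> phi; elim/syn_ind=> psi.
by rewrite syn_meetE !syn_map_pi syn_meetE.
Qed.

Fact syn_mapU : Order.join_morphism syn_map.
Proof.
elim/syn_ind=> phi; elim/syn_ind=> psi.
by rewrite syn_joinE !syn_map_pi syn_joinE.
Qed.

Fact syn_map0 : syn_map \bot = \bot.
Proof. exact: syn_map_pi. Qed.

Fact syn_map1 : syn_map \top = \top.
Proof. exact: syn_map_pi. Qed.

Definition syn_hom : lattice_hom (syn_lattice T X) (syn_lattice T Y) :=
  LatticeHom syn_mapI syn_mapU syn_map0 syn_map1.

End SyntacticMap.

Definition syn_doctrine (S : signature) (T : theory S) : functor FinSet DL.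
Proof.
refine (@Functor FinSet DL (fun X => syn_lattice T X)
  (fun X Y f => syn_hom T f) _ _).
- move=> X; apply: lattice_hom_eq; elim/syn_ind=> phi.
  by rewrite /= syn_map_pi subst_id.
- move=> X Y Z g f; apply: lattice_hom_eq; elim/syn_ind=> phi.
  by rewrite /= !syn_map_pi subst_comp.
Defined.

Definition syn_doctrine_delta (S : signature) (T : theory S) :
    functor FinSet CLat :=
  comp_functor delta_functor (syn_doctrine T).

Record structure (S : signature) := Structure {
  carrier :> Type;
  interp : forall R : S, ('I_(arity R) -> carrier) -> Prop
}.
Arguments interp {S} s R.

Fixpoint holds (S : signature) (M : structure S) (X : Type)
    (phi : formula S X) (v : X -> M) : Prop :=
  match phi with
  | Atom R x => interp M R (v \o x)
  | Equal x y => v x = v y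
  | Top => True
  | Bot => False
  | And phi psi => holds phi v /\ holds psi v
  | Or phi psi => holds phi v \/ holds psi v
  | Ex phi => exists m : M, holds phi (oapp v m)
  end.

Definition model (S : signature) (T : theory S) (M : structure S) : Prop :=
  forall s : sequent S, T s -> forall v : 'I_(seq_ctx s) -> M,
  holds (antecedent s) v -> holds (succedent s) v.

Record structure_hom (S : signature) (M N : structure S) := StructureHom {
  shom :> M -> N;
  shom_interp : forall (R : S) (x : 'I_(arity R) -> M),
    interp M R x -> interp N R (shom \o x)
}.

Lemma structure_hom_eq (S : signature) (M N : structure S)
  (f g : structure_hom M N) : f = g :> (M -> N) -> f = g.
Proof.
case: f g => [f fP] [g gP] /= fg; case: _ / fg in gP *.
by congr StructureHom; exact: Prop_irrelevance.
Qed.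

Definition structure_id (S : signature) (M : structure S) :
  structure_hom M M := @StructureHom S M M id (fun _ _ => id).

Definition structure_comp (S : signature) (M N P : structure S)
    (g : structure_hom N P) (f : structure_hom M N) : structure_hom M P :=
  @StructureHom S M P (g \o f)
    (fun R x Rx => shom_interp g (shom_interp f Rx)).

(* The valuation (m, n) of M^X x M^Y = M^(X + Y).                             *)
Definition pair_val (M X Y : Type) (m : X -> M) (n : Y -> M) (z : X + Y) : M :=
  match z with inl x => m x | inr y => n y end.

Section Types.
Context (S : signature) (M : structure S).

Definition conj_closed (X : Type) (tau : set (formula S X)) : Prop :=
  tau Top /\ forall phi psi, tau phi -> tau psi -> tau (And phi psi).

Definition consistent_type (X Y : Type) (tau : set (formula S (X + Y)))
    (m : X -> M) : Prop :=
  forall phi, tau phi -> exists n : Y -> M, holds phi (pair_val m n).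

Definition realised_type (X Y : Type) (tau : set (formula S (X + Y)))
    (m : X -> M) : Prop :=
  exists n : Y -> M, forall phi, tau phi -> holds phi (pair_val m n).

Definition omega_saturated : Prop :=
  forall (X Y : finType) (tau : set (formula S (X + Y))) (m : X -> M),
  conj_closed tau -> consistent_type tau m -> realised_type tau m.

Record prime_type (T : theory S) (A : set M) (Y : Type)
    (tau : set (formula S (A + Y))) : Prop := PrimeType {
  pt_top : tau Top;
  pt_and : forall phi psi, tau phi -> tau psi -> tau (And phi psi);
  pt_entails : forall phi psi, entails T phi psi -> tau phi -> tau psi;
  pt_bot : ~ tau Bot;
  pt_or : forall phi psi, tau (Or phi psi) -> tau phi \/ tau psi;
  pt_consistent : consistent_type tau (fun a : A => val a)
}.

End Types.

Definition omega_stable (S : signature) (T : theory S) : Prop :=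
  forall (M : structure S), model T M -> forall A : set M, countable A ->
  forall Y : finType,
  countable [set tau : set (formula S (A + Y)) | prime_type T tau].

Record countable_saturated_model (S : signature) (T : theory S) :=
  CountableSaturatedModel {
    csm_structure :> structure S;
    csm_model : model T csm_structure;
    csm_countable : countable [set: csm_structure];
    csm_saturated : omega_saturated csm_structure
  }.

Definition omegaSat (S : signature) (T : theory S) : category.
Proof.
refine (@Category (countable_saturated_model T)
  (fun M N => structure_hom M N) (fun M => structure_id M)
  (fun _ _ _ g f => structure_comp g f) _ _ _);
  by move=> *; exact: structure_hom_eq.
Defined.

Definition forget (S : signature) (T : theory S) : functor (omegaSat T) Sets :=
  @Functor (omegaSat T) Sets (fun M => csm_structure M) (fun _ _ f => shom f)
    (fun _ => erefl) (fun _ _ _ _ _ => erefl).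

(* Main.v *)
From HB Require Import structures.
From mathcomp Require Import all_boot all_order.
From mathcomp Require Import boolp classical_sets functions cardinality.
Require Import Defs.

(* A completely prime filter of up-closed sets is principal, so complete maps *)
(* between canonical extensions are dual to monotone maps between spaces of   *)
(* prime filters, and the left-hand side says that the spaces of types of the *)
(* two theories over finite contexts are naturally order-isomorphic.          *)
(* Given such an isomorphism [a], a countable saturated model M becomes a     *)
(* model of T' on the same set by letting phi' hold at v when phi' belongs to *)
(* a (tp v); saturation handles the existential quantifier. Conversely, by    *)
(* omega-stability every type P is the type of a tuple v in a countable       *)
(* saturated M, and a P := tp_(F M) v does not depend on the choice of (M, v) *)
(* because tp v <= tp w is always witnessed by a homomorphism sending v to w, *)
(* which F preserves.                                                         *)

Set Implicit Arguments.
Unset Strict Implicit.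
Unset Printing Implicit Defensive.

Import Order.TTheory.
Local Open Scope classical_set_scope.
Local Open Scope order_scope.
Local Open Scope quotient_scope.

(** Both sides encode the same datum, a [spec_iso]: bijections between the prime types of [T] and of
    [T'] over each finite context, monotone in both directions and natural in the context. For
    doctrines this is duality between up-set lattices and posets of prime filters
    ([spec_iso_of_nat_iso], [nat_iso_of_spec_iso]).

    From a [spec_iso] to an equivalence, the key is the truth lemma [transport_holds]: in the
    transported structure a tuple realises exactly the image of its old type. Equality survives
    because a type contains $x = y$ exactly when it is invariant under collapsing $y$ to $x$, a
    condition on substitutions alone. Homomorphisms remain homomorphisms because they can only
    enlarge types.

    For the converse, [spec_realised_countable] makes every type the exact type of a tuple in a
    countable saturated model, and [extend_to_hom] turns inclusions of types into homomorphisms. So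
    the types, ordered by inclusion, are tuples in such models compared along homomorphisms, and an
    equivalence over sets preserves all of this.

    A type is realised by iterating [amalgam], which realises all one-point extensions of a type at
    once; after $\omega$ steps the limit is saturated, but it may be large. By $\omega$-stability
    the tuple lies in a countable part that repeats every type over its finite subsets, and this
    part is again saturated. *)

#[local] Arguments csm_model : clear implicits.
#[local] Arguments csm_model {S T} c.

(** * Coherent semantics *)

Section Semantics.
Variable S : signature.

Lemma holds_subst (M : structure S) X Y (f : X -> Y) (phi : formula S X)
  (v : Y -> M) : holds (subst f phi) v <-> holds phi (v \o f).
Proof.
elim: phi Y f v => //= {}X.
- by move=> phi IHphi psi IHpsi Y f v; rewrite IHphi IHpsi.
- by move=> phi IHphi psi IHpsi Y f v; rewrite IHphi IHpsi.
- move=> phi IH Y f v.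
  have E m : oapp v m \o omap f = oapp (v \o f) m by apply/funext => -[].
  by split=> -[m]; [rewrite IH E|rewrite -E -IH]; exists m.
Qed.

Lemma soundness (T : theory S) (M : structure S) : model T M ->
  forall X (phi psi : formula S X), entails T phi psi ->
  forall v : X -> M, holds phi v -> holds psi v.
Proof.
move=> MT X phi psi; elim=> {X phi psi} /=; try by move=> *; intuition.
- by move=> X Y f phi psi _ IH v; rewrite !holds_subst; exact: IH.
- move=> X x y phi v [xy]; rewrite !holds_subst.
  have -> // : v \o odflt x = v \o odflt y by apply/funext => -[].
- move=> X phi psi _ IH v [m /IH]; rewrite holds_subst.
  by rewrite (_ : _ \o Some = v).
- move=> X phi psi _ IH v pv; rewrite holds_subst; apply: IH.
  exists (v None); rewrite (_ : oapp _ _ = v) //.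
  by apply/funext => -[].
- move=> X phi psi v [pv [m pm]]; exists m; rewrite holds_subst.
  by split=> //; rewrite (_ : _ \o Some = v).
Qed.

Lemma hom_holds (M N : structure S) (h : structure_hom M N) X
  (phi : formula S X) (v : X -> M) : holds phi v -> holds phi (h \o v).
Proof.
elim: phi v => //= {}X.
- by move=> R x v; exact: shom_interp.
- by move=> x y v ->.
- by move=> phi IHphi psi IHpsi v [/IHphi ? /IHpsi].
- by move=> phi IHphi psi IHpsi v [/IHphi|/IHpsi]; [left|right].
- move=> phi IH v [m /IH]; exists (h m).
  by rewrite (_ : oapp _ _ = h \o oapp v m) //; apply/funext => -[].
Qed.

(** Saturation for one new variable, matching the way [Ex] binds; by [saturated1_omega] it is as
    strong as [omega_saturated]. *)
Definition saturated1 (M : structure S) : Prop :=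
  forall (X : finType) (tau : set (formula S (option X))) (v : X -> M),
  conj_closed tau -> (forall phi, tau phi -> holds (Ex phi) v) ->
  exists m : M, forall phi, tau phi -> holds phi (oapp v m).

Lemma conj_closed_subst X Y (f : X -> Y) (tau : set (formula S X)) :
  conj_closed tau ->
  conj_closed [set chi | exists2 phi, tau phi & chi = subst f phi].
Proof.
move=> [tau1 tauI]; split; first by exists Top.
move=> _ _ [phi tphi ->] [psi tpsi ->].
by exists (And phi psi) => //; exact: tauI.
Qed.

Lemma omega_saturated1 (M : structure S) : omega_saturated M -> saturated1 M.
Proof.
move=> sat X tau v tauI tauE.
pose f (z : option X) : X + unit := oapp inl (inr tt) z.
have fE m : pair_val v (fun _ => m) \o f = oapp v m by apply/funext => -[].
have [||n nP] := sat X unit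
    [set chi | exists2 phi, tau phi & chi = subst f phi] v.
- exact: conj_closed_subst.
- move=> _ [phi /tauE[m mP] ->]; exists (fun _ => m).
  by rewrite holds_subst fE.
exists (n tt) => phi tphi; rewrite -fE -holds_subst.
rewrite (_ : (fun=> n tt) = n); first by apply: nP; exists phi.
by apply/funext => -[].
Qed.

(** Variables are realised one at a time, by induction on the size of [Y]: quantify one of them
    away, realise the others, then realise it over them. *)
Lemma saturated1_omega (M : structure S) : saturated1 M -> omega_saturated M.
Proof.
move=> sat.
pose good (Y : finType) := forall (X : finType) (tau : set (formula S (X + Y)))
  (v : X -> M), conj_closed tau -> consistent_type tau v -> realised_type tau v.
have retract (Y Y' : finType) (f : Y -> Y') (g : Y' -> Y) :
    cancel f g -> good Y' -> good Y.
  move=> fK gY' X tau v tauI tauE.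
  pose h (z : X + Y) : X + Y' :=
    match z with inl x => inl x | inr y => inr (f y) end.
  have hE n : pair_val v n \o h = pair_val v (n \o f) by apply/funext => -[].
  have [||n nP] := gY' X [set chi | exists2 phi, tau phi & chi = subst h phi] v.
  - exact: conj_closed_subst.
  - move=> _ [phi /tauE[n nP] ->]; exists (n \o g); rewrite holds_subst hE.
    by rewrite (_ : _ \o f = n) //; apply/funext => y /=; rewrite fK.
  exists (n \o f) => phi tphi; rewrite -hE -holds_subst.
  by apply: nP; exists phi.
have goodS (Y : finType) : good Y -> good (option Y).
  move=> gY X tau v [tau1 tauI] tauE.
  pose h (z : X + option Y) : option (X + Y) :=
    match z with inl x => Some (inl x) | inr y => omap inr y end.
  have hE n m : oapp (pair_val v n) m \o h = pair_val v (oapp n m).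
    by apply/funext => -[|[]].
  have oappE (n : option Y -> M) : n = oapp (n \o Some) (n None).
    by apply/funext => -[].
  (* All consequences in [M] of the existentials are taken, since the existentials themselves need
     not be closed under conjunction. *)
  pose tau0 := [set chi : formula S (X + Y) | exists2 phi, tau phi &
    forall w : X + Y -> M, holds (Ex (subst h phi)) w -> holds chi w].
  have [||n nP] := gY X tau0 v.
  - split; first by exists Top.
    move=> p q [phi tphi pP] [psi tpsi qP].
    exists (And phi psi); first exact: tauI.
    by move=> w [m [m1 m2]]; split; [apply: pP|apply: qP]; exists m.
  - move=> chi [phi /tauE[n +] chiP]; rewrite (oappE n) -hE -holds_subst => nP.
    by exists (n \o Some); apply: chiP; exists (n None).
  have [||m mP] := sat _ [set chi | exists2 phi, tau phi & chi = subst h phi]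
      (pair_val v n).
  - exact: conj_closed_subst.
  - by move=> _ [phi tphi ->]; apply: nP; exists phi.
  exists (oapp n m) => phi tphi; rewrite -hE -holds_subst.
  by apply: mP; exists phi.
have good_ord k : good 'I_k.
  elim: k => [|k IH].
    (* There is only one empty tuple, so the witnesses for the formulae of [tau] all coincide. *)
    move=> X tau v [tau1 tauI] tauE; have [n _] := tauE _ tau1.
    exists n => phi /tauE[n' +]; rewrite (_ : n' = n) //.
    by apply/funext => -[].
  apply: (@retract _ _ (unlift ord0) (oapp (lift ord0) ord0)); last exact: goodS.
  by move=> i; case: unliftP => [j|] ->.
by move=> X Y; exact: (retract _ _ _ _ (@enum_rankK Y) (good_ord _) X).
Qed.

End Semantics.

(** * Types as prime filters *)

Definition spec (S : signature) (T : theory S) (X : Type) :=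
  pfilter (syn_lattice T X).

Definition smem (S : signature) (T : theory S) (X : Type) (P : spec T X)
  (phi : formula S X) : Prop := P (\pi_(syn_lattice T X) phi).

Definition sle (S : signature) (T : theory S) (X : Type) (P Q : spec T X) :=
  forall phi, smem P phi -> smem Q phi.

Definition pull (S : signature) (T : theory S) (X Y : Type) (f : X -> Y)
  (P : spec T Y) : spec T X := pfilter_preimage (syn_hom T f) P.

Section Spec.
Context (S : signature) (T : theory S).

Lemma smem_entails X (P : spec T X) phi psi :
  entails T phi psi -> smem P phi -> smem P psi.
Proof. by move=> /syn_leE; exact: (pf_le (pf_prime P)). Qed.

Lemma smem_top X (P : spec T X) : smem P Top.
Proof. exact: (pf1 (pf_prime P)). Qed.

Lemma smem_bot X (P : spec T X) : ~ smem P Bot.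
Proof. exact: (pf0 (pf_prime P)). Qed.

Lemma smem_and X (P : spec T X) phi psi :
  smem P (And phi psi) <-> smem P phi /\ smem P psi.
Proof.
split=> [H|[pP qP]].
  by split; apply: smem_entails H; [exact: ent_andl|exact: ent_andr].
by rewrite /smem -syn_meetE; exact: (pfI (pf_prime P)).
Qed.

Lemma smem_or X (P : spec T X) phi psi :
  smem P (Or phi psi) <-> smem P phi \/ smem P psi.
Proof.
split; first by rewrite /smem -syn_joinE; exact: (pfU (pf_prime P)).
by case; apply: smem_entails; [exact: ent_orl|exact: ent_orr].
Qed.

Lemma sleP X (P Q : spec T X) : sle P Q <-> pf_set P `<=` pf_set Q.
Proof. by split=> [PQ|PQ phi]; [elim/syn_ind=> phi; exact: PQ|exact: PQ]. Qed.

Lemma sle_anti X (P Q : spec T X) : sle P Q -> sle Q P -> P = Q.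
Proof. by move=> /sleP PQ /sleP QP; apply/pfilter_eq/seteqP. Qed.

Lemma spec_eq X (P Q : spec T X) : (forall phi, smem P phi <-> smem Q phi) ->
  P = Q.
Proof. by move=> PQ; apply: sle_anti => phi /PQ. Qed.

Lemma pullE X Y (f : X -> Y) (P : spec T Y) phi :
  smem (pull f P) phi <-> smem P (subst f phi).
Proof. by rewrite /smem /= syn_map_pi. Qed.

Lemma smem_eq_refl X (P : spec T X) x : smem P (Equal x x).
Proof. exact: smem_entails (ent_eq_refl T x) (smem_top P). Qed.

Lemma smem_eq_sym X (P : spec T X) x y :
  smem P (Equal x y) -> smem P (Equal y x).
Proof.
move=> xy; apply: smem_entails (ent_eq_subst T x y (Equal None (Some x))) _.
by apply/smem_and; split=> //; exact: smem_eq_refl.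
Qed.

Lemma smem_eq_trans X (P : spec T X) x y z :
  smem P (Equal x y) -> smem P (Equal y z) -> smem P (Equal x z).
Proof.
move=> xy yz; apply: smem_entails (ent_eq_subst T y z (Equal (Some x) None)) _.
exact/smem_and.
Qed.

Lemma spec_separation X (F I : set (formula S X)) :
  F Top -> (forall phi psi, F phi -> F psi -> F (And phi psi)) ->
  I Bot -> (forall phi psi, I phi -> I psi -> I (Or phi psi)) ->
  (forall phi psi, F phi -> I psi -> ~ entails T phi psi) ->
  exists P : spec T X, (forall phi, F phi -> smem P phi) /\
    (forall phi, I phi -> ~ smem P phi).
Proof.
move=> F1 FI I0 IU FIP.
have Fs (s : seq (syn_lattice T X)) :
    (forall a, a \in s -> exists2 phi, F phi & a = \pi phi) ->
    exists2 phi, F phi & \meet_(a <- s) a = \pi phi.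
  elim: s => [|a s IH] sF; first by exists Top; rewrite ?big_nil.
  have [|phi Fphi E] := IH; first by move=> b bs; apply: sF; rewrite in_cons bs orbT.
  have [psi Fpsi ->] := sF a (mem_head _ _).
  by exists (And psi phi); [exact: FI|rewrite big_cons E syn_meetE].
have Is (s : seq (syn_lattice T X)) :
    (forall a, a \in s -> exists2 phi, I phi & a = \pi phi) ->
    exists2 phi, I phi & \join_(a <- s) a = \pi phi.
  elim: s => [|a s IH] sF; first by exists Bot; rewrite ?big_nil.
  have [|phi Fphi E] := IH; first by move=> b bs; apply: sF; rewrite in_cons bs orbT.
  have [psi Fpsi ->] := sF a (mem_head _ _).
  by exists (Or psi phi); [exact: IU|rewrite big_cons E syn_joinE].
have [|P [Ppf FP IP]] := @prime_filter_separation _ (syn_lattice T X)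
    [set a | exists2 phi, F phi & a = \pi phi]
    [set a | exists2 phi, I phi & a = \pi phi].
  move=> s t /Fs[phi Fphi ->] /Is[psi Ipsi ->] /syn_leE; exact: FIP.
exists (PFilter Ppf); split=> phi phiP; first by apply: FP; exists phi.
by apply: IP; exists phi.
Qed.

Lemma ent_ex_intro X (phi : formula S (option X)) :
  entails T phi (subst Some (Ex phi)).
Proof. exact/ent_exr/ent_refl. Qed.

Lemma smem_ex X (P : spec T (option X)) phi :
  smem P phi -> smem (pull Some P) (Ex phi).
Proof. by move=> pP; apply/pullE/(smem_entails (ent_ex_intro phi)). Qed.

Lemma ent_ex_elim X (phi psi : formula S X) (chi : formula S (option X)) :
  entails T (And (subst Some phi) chi) (subst Some psi) ->
  entails T (And phi (Ex chi)) psi.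
Proof. by move=> /ent_exl; exact: ent_trans (ent_frobenius _ _ _). Qed.

(** Separate the filter generated by [F] and the image of [P] from the ideal generated by the image
    of the complement of [P], which is closed under disjunction because [P] is prime. Avoiding this
    ideal makes the restriction of [Q] equal to [P] and not merely larger. *)
Lemma spec_lift X Y (f : X -> Y) (P : spec T X) (F : set (formula S Y)) :
  F Top -> (forall phi psi, F phi -> F psi -> F (And phi psi)) ->
  (forall phi chi psi, smem P phi -> F chi ->
    entails T (And (subst f phi) chi) (subst f psi) -> smem P psi) ->
  exists Q : spec T Y, pull f Q = P /\ (forall phi, F phi -> smem Q phi).
Proof.
move=> F1 FI H.
have [|||||Q [QF QI]] := @spec_separation Y
  [set chi | exists phi theta, [/\ smem P phi, F theta &
     entails T (And (subst f phi) theta) chi]]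
  [set chi | exists2 psi, ~ smem P psi & entails T chi (subst f psi)].
- by exists Top, Top; split=> //; [exact: smem_top|exact: ent_top].
- move=> a b [p1 [t1 [Pp1 Ft1 e1]]] [p2 [t2 [Pp2 Ft2 e2]]].
  exists (And p1 p2), (And t1 t2); split; [exact/smem_and|exact: FI|].
  by apply: ent_and; [apply: ent_trans e1|apply: ent_trans e2];
    apply: and_mono => /=; do ?[exact: ent_andl|exact: ent_andr].
- by exists Bot; [exact: smem_bot|exact: ent_bot].
- move=> a b [p1 Pp1 e1] [p2 Pp2 e2]; exists (Or p1 p2); last exact: or_mono.
  by move/smem_or=> [].
- move=> a b [p [t [Pp Ft e1]]] [q nPq e2] ab; apply: nPq; apply: (H p t) => //.
  exact: ent_trans e1 (ent_trans ab e2).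
exists Q; split; last first.
  move=> phi Fphi; apply: QF; exists Top, phi; split=> //; first exact: smem_top.
  exact: ent_andr.
apply: spec_eq => phi; split; rewrite pullE => phiP; last first.
  apply: QF; exists phi, Top; split=> //; exact: ent_andl.
by apply: contrapT => nPphi; apply: (QI _ _ phiP); exists phi => //; exact: ent_refl.
Qed.

(** By Frobenius, whatever [phi] and a member [chi] of [F] entail about the old variables already
    follows from [phi] and [Ex chi]. *)
Lemma spec_lift_ex X (P : spec T X) (F : set (formula S (option X))) :
  conj_closed F -> (forall phi, F phi -> smem P (Ex phi)) ->
  exists Q : spec T (option X),
    pull Some Q = P /\ (forall phi, F phi -> smem Q phi).
Proof.
move=> [F1 FI] FE; apply: spec_lift => // phi chi psi pP /FE cP /ent_ex_elim.
by move/smem_entails; apply; exact/smem_and.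
Qed.

End Spec.

(** * The type of a tuple in a model *)

Section TypeOf.
Context (S : signature) (T : theory S) (M : structure S) (MT : model T M).

Fact tp_prime X (v : X -> M) :
  prime_filter [set a : syn_lattice T X | holds (repr a) v].
Proof.
have E phi : holds (repr (\pi_(syn_lattice T X) phi)) v <-> holds phi v.
  by have [a b] := repr_entails T phi; split; apply: (soundness MT).
split=> /=.
- by apply/E.
- elim/syn_ind=> phi; elim/syn_ind=> psi /E p /E q.
  by rewrite syn_meetE; apply/E.
- elim/syn_ind=> phi; elim/syn_ind=> psi /syn_leE e /E p.
  by apply/E/(soundness MT e).
- by move/E.
- elim/syn_ind=> phi; elim/syn_ind=> psi.
  by rewrite syn_joinE => /E[]/E; [left|right].
Qed.

Definition tp X (v : X -> M) : spec T X := PFilter (tp_prime v).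

Lemma tpE X (v : X -> M) phi : smem (tp v) phi <-> holds phi v.
Proof.
by have [a b] := repr_entails T phi; split; apply: (soundness MT).
Qed.

Lemma pull_tp X Y (f : X -> Y) (v : Y -> M) : pull f (tp v) = tp (v \o f).
Proof. by apply: spec_eq => phi; rewrite pullE !tpE holds_subst. Qed.

(** The conclusion is an inclusion: without negation, saturation cannot prevent [m] from satisfying
    more than [Q]. *)
Lemma tp_realise (X : finType) (v : X -> M) (Q : spec T (option X)) :
  saturated1 M -> sle (pull Some Q) (tp v) ->
  exists m : M, sle Q (tp (oapp v m)).
Proof.
move=> sat Qv; have [||m mP] := sat X [set phi | smem Q phi] v.
- split; first exact: smem_top.
  by move=> phi psi p q; apply/smem_and.
- by move=> phi /smem_ex/Qv/tpE.
by exists m => phi /mP/tpE.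
Qed.

End TypeOf.

(** * Saturated models realising a given type *)

Section Amalgam.
Context (S : signature) (T : theory S) (X : Type) (P : spec T X).

(** One-point extensions of [P]; in [amalgam] each of them doubles as the new variable that realises
    it. *)
Definition ext1 := {t : spec T (option X) | pull Some t = P}.

Definition ext1_var (t : ext1) (z : option X) : X + ext1 :=
  if z is Some x then inl x else inr t.

HB.instance Definition _ := gen_eqMixin ext1.

Definition conj_ext1 (l : seq ext1) (th : ext1 -> formula S (option X)) :
    formula S (X + ext1) :=
  foldr (fun t chi => And chi (subst (ext1_var t) (th t))) Top l.

Lemma conj_ext1_entails l th t : t \in l ->
  entails T (conj_ext1 l th) (subst (ext1_var t) (th t)).
Proof.
elim: l => //= s l IH; rewrite in_cons => /predU1P[->|/IH]; first exact: ent_andr.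
exact/ent_trans/ent_andl.
Qed.

Lemma conj_ext1_mono l th l' th' : {subset l <= l'} ->
  (forall t, entails T (th' t) (th t)) ->
  entails T (conj_ext1 l' th') (conj_ext1 l th).
Proof.
move=> + thth'; elim: l => [|t l IH] ll'; first exact: ent_top.
apply: ent_and; first by apply: IH => s sl; apply: ll'; rewrite in_cons sl orbT.
apply: ent_trans (ent_subst _ (thth' t)).
by apply: conj_ext1_entails; apply: ll'; rewrite mem_head.
Qed.

Lemma ext1_ex (t : ext1) phi : smem (sval t) phi -> smem P (Ex phi).
Proof. by case: t => t /= tP /smem_ex; rewrite tP. Qed.

(* If [X] is empty, then [X + ext1] only maps to [option X]; the existential  *)
(* [Ex Top] that this costs belongs to [P] as soon as [ext1] is inhabited.    *)
Lemma ext1_conservative phi psi : smem P phi ->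
  entails T (subst inl phi : formula S (X + ext1)) (subst inl psi) ->
  smem P psi.
Proof.
move=> pP e; have [[t _]|noext] := pselect (exists t : ext1, True); last first.
  pose f (z : X + ext1) : X :=
    match z with
    | inl x => x
    | inr t => False_rect _ (noext (ex_intro _ t I))
    end.
  have := ent_subst f e; rewrite !subst_comp.
  by rewrite (_ : f \o inl = id) // !subst_id => /smem_entails; exact.
pose f (z : X + ext1) : option X := if z is inl x then Some x else None.
have := ent_subst f e; rewrite !subst_comp (_ : f \o inl = Some) // => e'.
have /ent_ex_elim : entails T (And (subst Some phi) Top) (subst Some psi).
  exact: ent_trans (ent_andl _ _ _) e'.
move/smem_entails; apply; apply/smem_and; split=> //.
exact/(@ext1_ex t)/smem_top.
Qed.

(** The variable of [t] occurs in no other conjunct, so it can be quantified away; [Ex (th t)]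
    belongs to [P] and is absorbed into [phi]. *)
Lemma conj_ext1_conservative l th phi psi : uniq l ->
  (forall t, smem (sval t) (th t)) -> smem P phi ->
  entails T (And (subst inl phi) (conj_ext1 l th)) (subst inl psi) ->
  smem P psi.
Proof.
move=> + thP; elim: l phi => [|t l IH] phi /=.
  move=> _ pP e; apply: (ext1_conservative pP); apply: ent_trans e.
  by apply: ent_and; [exact: ent_refl|exact: ent_top].
move=> /andP[tl ul] pP e; apply: (IH (And phi (Ex (th t))) ul).
  by apply/smem_and; split=> //; exact/(@ext1_ex t)/thP.
(* [f] makes the variable of [t] the bound one and weakens all the others; it therefore acts as
   [Some] on the conjuncts of [l], which omits [t]. *)
pose f (z : X + ext1) : option (X + ext1) :=
  match z with
  | inl x => Some (inl x)
  | inr s => if s == t then None else Some z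
  end.
have fl : subst f (conj_ext1 l th) = subst Some (conj_ext1 l th).
  elim: l tl {e ul IH} => //= s l IH; rewrite in_cons negb_or => /andP[ts /IH->].
  rewrite !subst_comp; congr (And _ (subst _ _)); apply/funext => -[x|] //=.
  by rewrite eq_sym (negbTE ts).
have := ent_subst f e; rewrite /= fl !subst_comp.
rewrite (_ : f \o ext1_var t = omap inl); last first.
  by apply/funext => -[x|] //=; rewrite eqxx.
rewrite (_ : f \o inl = Some \o inl) // -(subst_comp Some inl phi).
rewrite -(subst_comp Some inl psi) => e'.
have {}e' : entails T (And (subst inl phi : formula S (X + ext1))
    (And (conj_ext1 l th) (subst inl (Ex (th t))))) (subst inl psi).
  have : entails T (And (And (subst inl phi) (conj_ext1 l th))
      (Ex (subst (omap inl) (th t)))) (subst inl psi).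
    apply/ent_ex_elim/(ent_trans _ e').
    apply: ent_and; first exact: ent_trans (ent_andl _ _ _) (ent_andl _ _ _).
    apply: and_mono; last exact: ent_refl.
    exact: ent_andr.
  apply: ent_trans; apply: ent_and; first apply: and_mono.
  - exact: ent_refl.
  - exact: ent_andl.
  - exact: ent_trans (ent_andr _ _ _) (ent_andr _ _ _).
apply: ent_trans e'; rewrite /=; apply: ent_and.
  exact: ent_trans (ent_andl _ _ _) (ent_andl _ _ _).
apply: ent_and; first exact: ent_andr.
exact: ent_trans (ent_andl _ _ _) (ent_andr _ _ _).
Qed.

(** By compactness an entailment involves finitely many new variables, and [conj_ext1_conservative]
    eliminates those. *)
Lemma amalgam : exists Q : spec T (X + ext1), pull inl Q = P /\
  forall t, sle (sval t) (pull (ext1_var t) Q).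
Proof.
have [|||Q [QP QF]] := @spec_lift S T _ _ inl P
  [set chi : formula S (X + ext1) |
    exists (l : seq ext1) (th : ext1 -> formula S (option X)), [/\ uniq l,
    forall t, smem (sval t) (th t) & entails T (conj_ext1 l th) chi]].
- exists [::], (fun=> Top); split=> //; last exact: ent_top.
  by move=> t; exact: smem_top.
- move=> a b [l1 [th1 [_ P1 e1]]] [l2 [th2 [_ P2 e2]]].
  exists (undup (l1 ++ l2)), (fun t => And (th1 t) (th2 t)).
  split; [exact: undup_uniq|by move=> t; apply/smem_and|].
  apply: ent_and; [apply: ent_trans e1|apply: ent_trans e2];
    apply: conj_ext1_mono => t.
  + by rewrite mem_undup mem_cat => ->.
  + exact: ent_andl.
  + by rewrite mem_undup mem_cat => ->; rewrite orbT.
  + exact: ent_andr.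
- move=> phi chi psi pP [l [th [ul thP e]]] e'.
  apply: (conj_ext1_conservative ul thP pP); apply: ent_trans e'.
  by apply: and_mono => //; exact: ent_refl.
exists Q; split=> // t phi pt; apply/pullE/QF.
exists [:: t : ext1], (fun s : ext1 => if s == t :> ext1 then phi else Top).
split=> //.
  by move=> s; case: eqP => [->|_] //; exact: smem_top.
by rewrite /= eqxx; exact: ent_andr.
Qed.

End Amalgam.

(** [ent_eq_subst] replaces one variable, so [u] is turned into [u'] along an enumeration of the
    finite [Y]. *)
Lemma smem_replace (S : signature) (T : theory S) X (Y : finType)
    (P : spec T X) (u u' : Y -> X) (phi : formula S Y) :
  (forall y, smem P (Equal (u y) (u' y))) -> smem P (subst u phi) ->
  smem P (subst u' phi).
Proof.
move=> uu' pu; pose w (l : seq Y) y := if y \in l then u' y else u y.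
suff /(_ (enum Y)) : forall l, smem P (subst (w l) phi).
  by rewrite (_ : w _ = u') //; apply/funext => y; rewrite /w mem_enum.
elim=> [|x l IH]; first by rewrite (_ : w _ = u).
pose r y := if y == x then None else Some (w l y).
have [xl|xl] := boolP (x \in l).
  rewrite (_ : w _ = w l) //; apply/funext => y.
  by rewrite /w in_cons; case: eqP => [->|]; rewrite ?xl.
have := ent_eq_subst T (u x) (u' x) (subst r phi); rewrite !subst_comp.
rewrite (_ : _ \o r = w l); last first.
  by apply/funext => y; rewrite /= /r; case: eqP => //= ->; rewrite /w (negbTE xl).
rewrite (_ : _ \o r = w (x :: l)); last first.
  by apply/funext => y; rewrite /= /r /w in_cons; case: eqP => //= ->.
by move=> /smem_entails; apply; apply/smem_and.
Qed.

Lemma quotient_exists (Z : Type) (R : Z -> Z -> Prop) :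
  (forall x, R x x) -> (forall x y, R x y -> R y x) ->
  (forall x y z, R x y -> R y z -> R x z) ->
  exists (M : Type) (q : Z -> M),
    (forall m, exists z, m = q z) /\ (forall x y, q x = q y <-> R x y).
Proof.
move=> Rxx Rsym Rtr; exists {c : set Z | exists z, c = [set y | R z y]}.
exists (fun z => exist _ [set y | R z y] (ex_intro _ z erefl)); split.
  by move=> [c [z cz]]; exists z; exact: eq_exist.
move=> x y; split=> [[] /(congr1 (fun A : set Z => A y)) /= -> //|xy].
apply/eq_exist/seteqP; split=> z /=; apply: Rtr => //; exact: Rsym.
Qed.

(** * The limit of an $\omega$-chain of amalgams *)

Section Limit.
Context (S : signature) (T : theory S) (X0 : finType) (P0 : spec T X0).

Record stage := Stage { ctx : Type; sp : spec T ctx }.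

Definition next (s : stage) : stage := Stage (sval (cid (amalgam (sp s)))).

Definition st n : stage := iter n next (Stage P0).

(* The direct limit of the contexts [ctx (st n)], presented without quotient. *)
Definition colim : Type := (X0 + {n & ext1 (sp (st n))})%type.

Fixpoint emb n : ctx (st n) -> colim :=
  match n with
  | 0 => inl
  | k.+1 => fun z => match z with
      | inl x => emb x
      | inr t => inr (existT (fun n => ext1 (sp (st n))) k t)
      end
  end.

Lemma emb_fresh n (x : ctx (st n)) k (t : ext1 (sp (st k))) :
  emb x = inr (existT _ k t) -> (k < n)%N.
Proof.
elim: n x => //= n IH [x /IH /ltnW//|s e].
by rewrite -[k](congr1 (fun z : colim => if z is inr p then projT1 p else 0%N) e).
Qed.

Lemma emb_inj n : injective (@emb n).
Proof.
elim: n => [x y []//|n IH] [x|s] [y|t] /=.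
- by move/IH ->.
- by move/emb_fresh; rewrite ltnn.
- by move/esym/emb_fresh; rewrite ltnn.
- move=> e; congr inr; pose B n := ext1 (sp (st n)).
  (* Injectivity of [existT] in its second component, by proof irrelevance of equalities. *)
  have existT_inj (p q : {n & B n}) : p = q -> forall e : projT1 p = projT1 q,
      eq_rect _ B (projT2 p) _ e = projT2 q.
    by move=> <- e'; rewrite (Prop_irrelevance e' erefl).
  pose f (z : colim) := if z is inr p then p else existT B n s.
  exact: (existT_inj _ _ (congr1 f e) erefl).
Qed.

Lemma emb_surj z : exists n (x : ctx (st n)), z = emb x.
Proof.
case: z => [x|[n t]]; first by exists 0%N, x.
by exists n.+1, (inr t).
Qed.

(** Truth is stable along the chain because each amalgam restricts exactly to the type it
    extends. *)
Lemma emb_raise Y n N (u : Y -> ctx (st n)) : (n <= N)%N ->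
  exists u' : Y -> ctx (st N), (@emb N) \o u' = (@emb n) \o u /\
    forall phi, smem (sp (st N)) (subst u' phi) <-> smem (sp (st n)) (subst u phi).
Proof.
move=> /subnK <-; elim: (N - n)%N => [|k [u' [u'E u'P]]]; first by exists u.
exists (inl \o u'); split; first by rewrite -u'E.
move=> phi; rewrite -u'P -subst_comp -pullE.
by have [-> _] := svalP (cid (amalgam (sp (st (k + n))))).
Qed.

Definition lim Y (phi : formula S Y) (v : Y -> colim) : Prop :=
  exists n (u : Y -> ctx (st n)), v = @emb n \o u /\
    smem (sp (st n)) (subst u phi).

Lemma limE Y (phi : formula S Y) n (u : Y -> ctx (st n)) :
  lim phi (@emb n \o u) <-> smem (sp (st n)) (subst u phi).
Proof.
split=> [[k [w [E p]]]|p]; last by exists n, u.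
have [u' [u'E u'P]] := emb_raise u (leq_maxl n k).
have [w' [w'E w'P]] := emb_raise w (leq_maxr n k).
apply/u'P; rewrite (_ : u' = w'); first exact/w'P.
apply/funext => y; apply: (@emb_inj (maxn n k)).
by move: (congr1 (@^~ y) u'E) (congr1 (@^~ y) w'E); rewrite E /= => -> ->.
Qed.

(** Stands in for finiteness of [Y]: the induction on formulae in [lim_model] runs over contexts
    that are mere types. *)
Definition reached Y := forall v : Y -> colim,
  exists n (u : Y -> ctx (st n)), v = @emb n \o u.

Lemma reached_option Y : reached Y -> reached (option Y).
Proof.
move=> rY v; have [n [u uE]] := rY (v \o Some).
have [k [x xE]] := emb_surj (v None).
have [u' [u'E _]] := emb_raise u (leq_maxl n k).
have [w [wE _]] := emb_raise (fun _ : unit => x) (leq_maxr n k).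
exists (maxn n k), (oapp u' (w tt)); apply/funext => -[y|] /=.
  by move: (congr1 (@^~ y) u'E) (congr1 (@^~ y) uE) => /= -> ->.
by rewrite xE; move: (congr1 (@^~ tt) wE) => /= ->.
Qed.

Lemma reached_fin (Y : finType) : reached Y.
Proof.
move=> v; have [n nP] := choice (fun y => emb_surj (v y)).
pose N := \max_y n y; suff [u uE] : exists u : Y -> ctx (st N),
    forall y, v y = emb (u y) by exists N, u; apply/funext.
suff : forall y, exists x : ctx (st N), v y = emb x by move=> /choice[u uE]; exists u.
move=> y; have [x ->] := nP y.
have [u [uE _]] := emb_raise (fun _ : unit => x) (leq_bigmax y : (n y <= N)%N).
by exists (u tt); exact: esym (congr1 (@^~ tt) uE).
Qed.

(** The tuple lives at some stage [n]; there [F] extends to a prime one-point extension, which stage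
    [n.+1] realises. *)
Lemma lim_realise Y (v : Y -> colim) (F : set (formula S (option Y))) :
  reached Y -> conj_closed F -> (forall phi, F phi -> lim (Ex phi) v) ->
  exists z, forall phi, F phi -> lim phi (oapp v z).
Proof.
move=> /(_ v)[n [u ->]] FI FE.
have [||Q [QP QF]] := @spec_lift_ex _ _ _ (sp (st n))
    [set chi | exists2 phi, F phi & chi = subst (omap u) phi].
- exact: conj_closed_subst.
- by move=> _ [phi /FE/limE pF ->].
pose t : ext1 (sp (st n)) := exist _ Q QP.
exists (@emb n.+1 (inr t)) => phi pF.
rewrite (_ : oapp _ _ = @emb n.+1 \o oapp (inl \o u) (inr t)); last first.
  by apply/funext => -[].
apply/limE; have [_ /(_ t (subst (omap u) phi))] :=
  svalP (cid (amalgam (sp (st n)))).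
rewrite pullE subst_comp (_ : _ \o _ = oapp (inl \o u) (inr t)); last first.
  by apply/funext => -[].
by apply; apply: QF; exists phi.
Qed.

Lemma lim_entails Y (v : Y -> colim) phi psi :
  entails T phi psi -> lim phi v -> lim psi v.
Proof.
move=> e [n [u [-> p]]]; apply/limE; apply: smem_entails p.
exact: ent_subst.
Qed.

Lemma lim_ex Y (v : Y -> colim) phi : reached Y ->
  lim (Ex phi) v <-> exists z, lim phi (oapp v z).
Proof.
move=> rY; split=> [p|[z [n [u [E p]]]]].
  (* All consequences of [phi], to have a set closed under conjunction. *)
  have [||z zP] := @lim_realise _ v [set chi | entails T phi chi] rY.
  - split; first exact: ent_top.
    by move=> a b; exact: ent_and.
  - move=> chi /= e; apply: lim_entails p.
    exact/ent_exl/(ent_trans e)/ent_ex_intro.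
  by exists z; apply: zP; exact: ent_refl.
have -> : v = @emb n \o (u \o Some).
  by apply/funext => y; rewrite -[LHS]/(oapp v z (Some y)) E.
apply/limE; rewrite -subst_comp; apply: smem_entails p.
exact/ent_subst/ent_ex_intro.
Qed.

Definition lim_eq (x y : colim) : Prop :=
  lim (Equal true false) (fun b : bool => if b then x else y).

Lemma lim_eqE n (x y : ctx (st n)) :
  lim_eq (emb x) (emb y) <-> smem (sp (st n)) (Equal x y).
Proof.
rewrite /lim_eq (_ : (fun b => _) = @emb n \o (fun b : bool => if b then x else y)).
  by rewrite limE.
by apply/funext => -[].
Qed.

(** The model is the limit modulo provable equality. An atom holds when some representing tuple
    satisfies it; [smem_replace] makes the choice of representatives immaterial. *)
Lemma lim_model : exists (M : structure S) (q : colim -> M),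
  (forall m, exists z, m = q z) /\
  forall Y (phi : formula S Y) (v : Y -> colim), reached Y ->
    holds phi (q \o v) <-> lim phi v.
Proof.
have [|||Q [q [qsurj qE]]] := @quotient_exists colim lim_eq.
- by move=> z; have [n [x ->]] := emb_surj z; apply/lim_eqE/smem_eq_refl.
- move=> x y; have [n [u E]] := @reached_fin bool (fun b => if b then x else y).
  move: (congr1 (@^~ true) E) (congr1 (@^~ false) E) => /= -> ->.
  by rewrite !lim_eqE; exact: smem_eq_sym.
- move=> x y z; have [n [u E]] := @reached_fin (option bool)
    (oapp (fun b : bool => if b then x else y) z).
  move: (congr1 (@^~ (Some true)) E) (congr1 (@^~ (Some false)) E) => /= -> ->.
  move: (congr1 (@^~ None) E) => /= ->; rewrite !lim_eqE; exact: smem_eq_trans.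
exists (@Structure S Q (fun R x => exists v, x = q \o v /\ lim (Atom R id) v)), q.
split=> // Y phi; elim: phi => /= {}Y.
- move=> R x v rY; have [n [u ->]] := rY v; rewrite limE /=.
  split=> [[w [E]]|p]; last first.
    by exists (@emb n \o (u \o x)); split=> //; exact/limE.
  have [k [w' wE]] := reached_fin w; rewrite wE limE => p.
  have [u1 [u1E u1P]] := emb_raise (u \o x) (leq_maxl n k).
  have [w1 [w1E w1P]] := emb_raise w' (leq_maxr n k).
  apply/(u1P (Atom R id)); move/w1P: p; apply: smem_replace => i.
  apply/lim_eqE/qE; rewrite -[emb _]/((emb (n:=_) \o w1) i) w1E.
  rewrite -[emb (u1 i)]/((emb (n:=_) \o u1) i) u1E.
  by rewrite -wE; exact: esym (congr1 (@^~ i) E).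
- by move=> x y v rY; have [n [u ->]] := rY v; rewrite limE qE lim_eqE.
- move=> v rY; have [n [u ->]] := rY v; rewrite limE; split=> // _.
  exact: smem_top.
- by move=> v rY; have [n [u ->]] := rY v; rewrite limE; split=> // /smem_bot.
- move=> phi IHphi psi IHpsi v rY; rewrite IHphi // IHpsi //.
  by have [n [u ->]] := rY v; rewrite !limE smem_and.
- move=> phi IHphi psi IHpsi v rY; rewrite IHphi // IHpsi //.
  by have [n [u ->]] := rY v; rewrite !limE smem_or.
- move=> phi IH v rY; rewrite lim_ex //.
  have E z : oapp (q \o v) (q z) = q \o oapp v z by apply/funext => -[].
  split=> [[m]|[z]].
    have [z ->] := qsurj m; rewrite E IH; last exact: reached_option.
    by exists z.
  by rewrite -IH; [exists (q z); rewrite E|exact: reached_option].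
Qed.

Theorem spec_realised : exists (M : structure S) (v : X0 -> M),
  [/\ model T M, saturated1 M & forall phi, holds phi v <-> smem P0 phi].
Proof.
have [M [q [qsurj qE]]] := lim_model.
have lift_val Y (v : Y -> M) : exists w, v = q \o w.
  by have [w wE] := choice (fun y => qsurj (v y)); exists w; apply/funext.
exists M, (q \o inl); split.
- move=> s Ts v; have [w ->] := lift_val _ v; rewrite !qE; try exact: reached_fin.
  exact/lim_entails/ent_axiom.
- move=> X tau v tauI; have [w ->] := lift_val _ v => tauE.
  have [||z zP] := @lim_realise _ w tau _ tauI; first exact: reached_fin.
    by move=> phi /tauE/qE; apply; exact: reached_fin.
  exists (q z) => phi /zP /qE; rewrite (_ : oapp _ _ = q \o oapp w z).
    by apply; exact/reached_option/reached_fin.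
  by apply/funext => -[].
- move=> phi; rewrite qE; last exact: reached_fin.
  by rewrite -{2}[phi]subst_id -(limE phi (n:=0%N) id).
Qed.

End Limit.

(** * Countable saturated models *)

Lemma countable_union U (A B : set U) :
  countable A -> countable B -> countable (A `|` B)%classic.
Proof.
move=> Ac Bc; rewrite (_ : (_ `|` _)%classic = \bigcup_(b : bool) if b then A else B).
  by apply: bigcup_countable => [|[] _//]; exact: countableP.
by apply/seteqP; split=> [x [?|?]|x [[] _ ?]]; [exists true|exists false|left|right].
Qed.

Section DownwardLowenheimSkolem.
Context (S : signature) (T : theory S) (T_stable : omega_stable T).
Context (M : structure S) (MT : model T M) (Msat : saturated1 M).

Definition tp_over (A : set M) (b : M) : set (formula S (A + unit)) :=
  [set phi | holds phi (pair_val (fun a : A => val a) (fun _ => b))].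
Arguments tp_over : clear implicits.

Lemma tp_over_prime (A : set M) b : prime_type T (tp_over A b).
Proof.
split=> //=.
- by move=> phi psi e; exact: soundness MT _ _ _ e _.
- by move=> phi phib; exists (fun _ => b).
Qed.

(** The type over [A] of an element is prime, so stability leaves countably many types, and one
    realisation of each is added to [A]. *)
Lemma realise_types_over (A : set M) : countable A -> exists B : set M,
  [/\ countable B, A `<=` B &
   forall b, exists2 b', B b' & tp_over A b' = tp_over A b].
Proof.
move=> Acount.
(* The value is [None] when no element of [M] has exactly the type [tau]. *)
pose rep tau : option M :=
  if pselect (exists b, tp_over A b = tau) is left e then Some (sval (cid e))
  else None.
exists (A `|` \bigcup_(tau in [set tau : set (formula S (A + unit)) |
  prime_type T tau]) [set b | rep tau = Some b])%classic; split.
- apply: countable_union => //; apply: bigcup_countable; first exact: T_stable.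
  move=> tau _; case: (rep tau) => [b|].
    by apply: sub_countable (countable1 b); apply: subset_card_le => c [->].
  by rewrite (_ : mkset _ = set0) //; apply/seteqP; split.
- by move=> a; left.
- move=> b; have [b' b'E] : exists b', rep (tp_over A b) = Some b' /\
      tp_over A b' = tp_over A b.
    rewrite /rep; case: pselect => [e|[]]; last by exists b.
    by exists (sval (cid e)); split=> //; exact: svalP (cid e).
  exists b'; last by case: b'E.
  right; exists (tp_over A b); first exact: tp_over_prime.
  by case: b'E.
Qed.

Variables (A0 : set M) (A0_countable : countable A0).

Definition closure_step (A : {A : set M | countable A}) :
    {A : set M | countable A} :=
  let: exist B BP := cid (realise_types_over (svalP A)) in
  exist _ B (let: And3 c _ _ := BP in c).

Definition closure_seq n : {A : set M | countable A} :=
  iter n closure_step (exist _ A0 A0_countable).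

Lemma closure_seqS n : sval (closure_seq n) `<=` sval (closure_seq n.+1).
Proof. by rewrite /= /closure_step; case: cid => B []. Qed.

Lemma closure_seq_mono n k : (n <= k)%N ->
  sval (closure_seq n) `<=` sval (closure_seq k).
Proof.
move=> /subnK <-; elim: (k - n)%N => // j IH.
by apply: subset_trans IH _; exact: closure_seqS.
Qed.

Lemma closure_seq_type n Y (v : Y -> M) b : (forall y, sval (closure_seq n) (v y)) ->
  exists2 b', sval (closure_seq n.+1) b' &
    forall phi, holds phi (oapp v b) <-> holds phi (oapp v b').
Proof.
move=> vA; have [b' Bb' E] : exists2 b', sval (closure_seq n.+1) b' &
    tp_over (sval (closure_seq n)) b' = tp_over (sval (closure_seq n)) b.
  by rewrite /= /closure_step; case: cid => B [].
exists b' => // phi.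
pose f (z : option Y) : sval (closure_seq n) + unit :=
  if z is Some y then inl (SigSub (mem_set (vA y))) else inr tt.
have fE c : pair_val (fun a : sval (closure_seq n) => val a) (fun _ => c) \o f =
    oapp v c by apply/funext => -[].
have := congr1 (fun tau => tau (subst f phi)) E.
by rewrite /tp_over /= => e; rewrite -(fE b) -(fE b') -!holds_subst e.
Qed.

Definition hull : set M := \bigcup_n sval (closure_seq n).

Lemma hull_countable : countable hull.
Proof. by apply: bigcup_countable => // n _; exact: (svalP (closure_seq n)). Qed.

Definition hull_structure : structure S :=
  @Structure S hull (fun R x => interp M R (fun i => val (x i))).

Definition in_hull (v : hull_structure) : M := val (v : hull).

Definition bounded Y := forall v : Y -> hull_structure,
  exists n, forall y, sval (closure_seq n) (in_hull (v y)).

Lemma bounded_option Y : bounded Y -> bounded (option Y).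
Proof.
move=> bY v; have [n nP] := bY (v \o Some).
have [k _ kP] := set_mem (valP (v None : hull)).
exists (maxn n k) => -[y|].
  exact: closure_seq_mono (leq_maxl _ _) _ (nP y).
exact: closure_seq_mono (leq_maxr _ _) _ kP.
Qed.

Lemma bounded_fin (Y : finType) : bounded Y.
Proof.
move=> v; have /choice[n nP] y : exists n, sval (closure_seq n) (in_hull (v y)).
  by have [n _ nP] := set_mem (valP (v y : hull)); exists n.
exists (\max_y n y) => y; apply: closure_seq_mono (nP y).
exact: (leq_bigmax y : (n y <= _)%N).
Qed.

Lemma hull_type Y (v : Y -> hull_structure) b : bounded Y ->
  exists c : hull_structure, forall phi,
    holds phi (oapp (in_hull \o v) b) <-> holds phi (in_hull \o oapp v c).
Proof.
move=> /(_ v)[n nP]; have [c Ac cP] := closure_seq_type b nP.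
have cH : hull c by exists n.+1.
exists (SigSub (mem_set cH)) => phi; rewrite cP.
by rewrite (_ : oapp _ _ = in_hull \o oapp v (SigSub (mem_set cH))) //;
  apply/funext => -[].
Qed.

(** Tarski-Vaught: [hull_type] moves a witness from [M] into the hull without changing its type over
    [v]. *)
Lemma hull_elementary Y (phi : formula S Y) (v : Y -> hull_structure) :
  bounded Y -> holds phi v <-> holds phi (in_hull \o v).
Proof.
elim: phi v => //= {}Y.
- by move=> x y v _; split=> [->//|/val_inj].
- by move=> phi IHphi psi IHpsi v bY; rewrite IHphi ?IHpsi.
- by move=> phi IHphi psi IHpsi v bY; rewrite IHphi ?IHpsi.
- move=> phi IH v bY; have E c : in_hull \o oapp v c =
    oapp (in_hull \o v) (in_hull c) by apply/funext => -[].
  split=> [[c]|[b]].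
    rewrite IH; last exact: bounded_option.
    by rewrite E; exists (in_hull c).
  have [c cP] := hull_type v b bY; rewrite cP -IH; last exact: bounded_option.
  by exists c.
Qed.

Lemma hull_model : model T hull_structure.
Proof.
move=> s Ts v; rewrite !hull_elementary; try exact: bounded_fin.
exact: MT.
Qed.

(** A realisation in [M] is replaced by an element of the hull with the same type over the
    parameters. *)
Lemma hull_saturated : saturated1 hull_structure.
Proof.
move=> X tau v tauI tauE.
have [|b bP] := Msat (v := in_hull \o v) tauI.
  by move=> phi /tauE/(hull_elementary _ _ (bounded_fin (Y:=X))).
have [c cP] := hull_type v b (bounded_fin (Y:=X)); exists c => phi /bP.
by rewrite cP hull_elementary //; exact/bounded_option/bounded_fin.
Qed.

Definition hull_csm : countable_saturated_model T.
Proof.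
exists hull_structure; [exact: hull_model| |exact/saturated1_omega/hull_saturated].
have := hull_countable; rewrite -(eq_countable (card_setT hull)); exact.
Defined.

End DownwardLowenheimSkolem.

Theorem spec_realised_countable (S : signature) (T : theory S) (X : finType)
    (P : spec T X) : omega_stable T ->
  exists (M : countable_saturated_model T) (v : X -> M),
    forall phi, holds phi v <-> smem P phi.
Proof.
move=> T_stable; have [M [v [MT Msat vP]]] := spec_realised P.
have A0c : countable (range v) by apply/finite_set_countable/finite_image/finite_finset.
exists (hull_csm T_stable MT Msat A0c).
have vH x : hull T_stable MT A0c (v x) by exists 0%N => //; exists x.
exists (fun x => SigSub (mem_set (vH x))) => phi.
by rewrite hull_elementary; [exact: vP|exact: bounded_fin].
Qed.

(** * Extending inclusions of types to homomorphisms *)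

Section Forth.
Context (S : signature) (M N : structure S) (Nsat : saturated1 N).

Record partial_hom := PartialHom {
  ph_dom : finType;
  ph_src : ph_dom -> M;
  ph_tgt : ph_dom -> N;
  ph_holds : forall phi : formula S ph_dom,
    holds phi ph_src -> holds phi ph_tgt
}.
Arguments ph_src : clear implicits.
Arguments ph_tgt : clear implicits.

Definition graph (p : partial_hom) : set (M * N) :=
  range (fun y => (ph_src p y, ph_tgt p y)).

Lemma partial_hom_extend (p : partial_hom) (m : M) : exists q : partial_hom,
  graph p `<=` graph q /\ exists n, graph q (m, n).
Proof.
have [||n nP] := Nsat (tau := [set phi | holds phi (oapp (ph_src p) m)])
  (v := ph_tgt p).
- by split.
- by move=> phi pm; apply: (ph_holds (phi := Ex phi)); exists m.
exists (PartialHom nP); split; last by exists n; exists None.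
by move=> _ [y _ <-]; exists (Some y).
Qed.

(** The forth half of a back-and-forth: run through the countable [M] and find each image in [N] by
    saturation. *)
Lemma extend_to_hom (X : finType) (v : X -> M) (w : X -> N) :
  countable [set: M] -> (forall phi, holds phi v -> holds phi w) ->
  exists h : structure_hom M N, forall x, h (v x) = w x.
Proof.
move=> /countable_injP[code codeI] vw.
have [ext extP] := choice (fun pm => partial_hom_extend pm.1 pm.2).
(* Step [n] treats the element with code [n], if there is one, so [m] has an image from stage
   [(code m).+1] on. *)
pose step n p := if pselect (exists m, code m = n) is left e
  then ext (p, sval (cid e)) else p.
pose ph n := iteri n step (PartialHom vw).
have ph_le n k : (n <= k)%N -> graph (ph n) `<=` graph (ph k).
  move=> /subnK <-; elim: (k - n)%N => // j IH; apply: subset_trans IH _.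
  rewrite -[ph (j.+1 + n)%N]/(step (j + n)%N (ph (j + n)%N)) /step.
  by case: pselect => [e|_] //; have [] := extP (ph (j + n)%N, sval (cid e)).
have total m : exists n, graph (ph (code m).+1) (m, n).
  rewrite -[ph _]/(step (code m) (ph (code m))) /step.
  case: pselect => [e|[]]; last by exists m.
  have em : sval (cid e) = m.
    by apply: (codeI _ _ _ _ (svalP (cid e))); rewrite in_setT.
  by have [_] := extP (ph (code m), sval (cid e)); rewrite {2}em.
have [h hP] := choice total.
(* Finitely many values of [h] all appear at one stage, where a single inclusion of types governs
   them. *)
have common (Y : finType) (f : Y -> M) (g : Y -> nat) :
    (forall y, graph (ph (g y)) (f y, h (f y))) ->
    exists n, exists u : Y -> ph_dom (ph n),
      f = ph_src (ph n) \o u /\ h \o f = ph_tgt (ph n) \o u.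
  move=> fg; exists (\max_y g y).
  have /choice[u uP] y : exists z, f y = ph_src (ph (\max_y g y)) z /\
      h (f y) = ph_tgt (ph (\max_y g y)) z.
    have [z _ [<- <-]] := ph_le _ _ (leq_bigmax y : (g y <= _)%N) _ (fg y).
    by exists z.
  by exists u; split; apply/funext => y; case: (uP y).
unshelve eexists (@StructureHom S M N h _).
- move=> R x Rx.
  have [n [u [xE hxE]]] := common _ x _ (fun i => hP (x i)).
  rewrite hxE; apply: (ph_holds (phi := Atom R u)); by rewrite /= -xE.
- move=> x /=; have [y _ [yE hE]] := ph_le _ _ (leq0n (code (v x)).+1) (v x, w x)
    (ex_intro2 _ _ x I erefl).
  have [z _ [zE <-]] := hP (v x); rewrite -hE.
  by apply: (ph_holds (phi := Equal z y)); rewrite /= zE yE.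
Qed.

End Forth.

(** * Natural isomorphisms of canonical extensions *)

Section Duality.
Variables L K : tbDistrLatticeType lattice_display.

Definition above (P : pfilter L) : upset L.
Proof. by exists [set Q | pf_set P `<=` Q] => Q R QR PQ a /PQ/QR. Defined.

(* The points at which [g u] holds, for [u] varying, form a complete prime    *)
(* filter of up-closed sets; such a filter is principal.                      *)
Lemma complete_hom_dual (g : complete_hom (delta L) (delta K)) (Q : pfilter K) :
  exists P : pfilter L, forall u : upset L, (g u : upset K) Q <-> u P.
Proof.
pose F := [set u : delta L | (g u : upset K) Q].
pose u0 : upset L := inf F.
have u0Q : (g u0 : upset K) Q by rewrite /u0 chom_inf => _ [u uQ <-].
have u0E : (u0 : delta L) = sup [set (above P : delta L) | P in up_set u0].
  apply: upset_eq => R; split=> [u0R|[_ [P u0P <-] PR]].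
    by exists (above R) => //; exists R.
  exact: upP PR u0P.
have [P u0P PQ] : exists2 P, u0 P & (g (above P) : upset K) Q.
  rewrite u0E in u0Q; move: u0Q; rewrite chom_sup => -[_ [_ [P u0P <-] <-] PQ].
  exists P; [exact: u0P|exact: PQ].
exists P => u; split=> [uQ|uP]; first exact: (u0P u uQ).
have Pu : (above P : delta L) <= u.
  by apply/upset_leP => R PR; exact: upP PR uP.
have -> : (u : delta L) = sup [set (above P : delta L); (u : delta L)].
  apply/le_anti/andP; split; first by apply: le_sup; right.
  by apply: sup_le => v [] ->.
rewrite chom_sup; exists (g (above P)) => //.
by exists (above P) => //; left.
Qed.

Definition dual (g : complete_hom (delta L) (delta K)) (Q : pfilter K) :
  pfilter L := sval (cid (complete_hom_dual g Q)).

Lemma dualE (g : complete_hom (delta L) (delta K)) Q (u : upset L) :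
  (g u : upset K) Q <-> u (dual g Q).
Proof. exact: (svalP (cid (complete_hom_dual g Q))). Qed.

Lemma delta_hom_congr (f g : complete_hom (delta L) (delta K)) :
  f = g -> forall u : upset L, f u = g u :> upset K.
Proof. by move=> ->. Qed.

End Duality.

Section MonotoneDual.
Context (L K : tbDistrLatticeType lattice_display) (d : pfilter K -> pfilter L).
Hypothesis d_mono : forall P Q, pf_set P `<=` pf_set Q ->
  pf_set (d P) `<=` pf_set (d Q).

Definition upset_preim (u : upset L) : upset K.
Proof. by exists [set Q | u (d Q)] => P Q /d_mono; exact: upP. Defined.

Lemma upset_preim_sup (A : set (delta L)) :
  upset_preim (sup A) = @sup (delta K) (upset_preim @` A).
Proof.
apply: upset_eq => P; split=> [[u Au uP]|[_ [u Au <-] uP]]; last by exists u.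
by exists (upset_preim u) => //; exists u.
Qed.

Lemma upset_preim_inf (A : set (delta L)) :
  upset_preim (inf A) = @inf (delta K) (upset_preim @` A).
Proof.
apply: upset_eq => P; split=> [H _ [u Au <-]|H u Au]; first exact: (H u).
by apply: (H (upset_preim u)); exists u.
Qed.

Definition preim_hom : complete_hom (delta L) (delta K) :=
  @CompleteHom (delta L) (delta K) upset_preim upset_preim_sup upset_preim_inf.

End MonotoneDual.

Record spec_iso (S S' : signature) (T : theory S) (T' : theory S') := SpecIso {
  si_fwd : forall X : finType, spec T X -> spec T' X;
  si_bwd : forall X : finType, spec T' X -> spec T X;
  si_fwdK : forall X, cancel (@si_fwd X) (@si_bwd X);
  si_bwdK : forall X, cancel (@si_bwd X) (@si_fwd X);
  si_fwd_le : forall X P Q, sle P Q -> sle (@si_fwd X P) (si_fwd Q);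
  si_bwd_le : forall X P Q, sle P Q -> sle (@si_bwd X P) (si_bwd Q);
  si_natural : forall (X Y : finType) (f : X -> Y) P,
    si_fwd (pull f P) = pull f (si_fwd P)
}.

Section SpecIso.
Context (S S' : signature) (T : theory S) (T' : theory S').

Lemma si_bwd_natural (a : spec_iso T T') (X Y : finType) (f : X -> Y) P :
  si_bwd a (pull f P) = pull f (si_bwd a P).
Proof. by rewrite -{1}(si_bwdK a P) -si_natural si_fwdK. Qed.

Definition spec_iso_sym (a : spec_iso T T') : spec_iso T' T :=
  SpecIso (si_bwdK a) (si_fwdK a) (@si_bwd_le _ _ _ _ a) (@si_fwd_le _ _ _ _ a)
    (@si_bwd_natural a).

Lemma above_inj (L : tbDistrLatticeType lattice_display) (P Q : pfilter L) :
  (forall u : upset L, u P -> u Q) -> pf_set P `<=` pf_set Q.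
Proof. by move=> /(_ (above P)); exact. Qed.

Lemma spec_iso_of_nat_iso :
  nat_iso (syn_doctrine_delta T) (syn_doctrine_delta T') ->
  inhabited (spec_iso T T').
Proof.
move=> [fwd bwd nat fwdK bwdK].
pose F (X : finType) :
  complete_hom (delta (syn_lattice T X)) (delta (syn_lattice T' X)) := fwd X.
pose G (X : finType) :
  complete_hom (delta (syn_lattice T' X)) (delta (syn_lattice T X)) := bwd X.
have fK (X : finType) (u : upset (syn_lattice T X)) : G X (F X u) = u.
  have e : complete_comp (G X) (F X) = complete_id _ := fwdK X.
  exact: (delta_hom_congr e).
have bK (X : finType) (u : upset (syn_lattice T' X)) : F X (G X u) = u.
  have e : complete_comp (F X) (G X) = complete_id _ := bwdK X.
  exact: (delta_hom_congr e).
(* Duality is contravariant: the forward map of lattices gives the backward map of types. *)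
pose b' (X : finType) (P : spec T' X) : spec T X := dual (F X) P.
pose c' (X : finType) (P : spec T X) : spec T' X := dual (G X) P.
have b'E (X : finType) (P : spec T' X) u := dualE (F X) P u.
have c'E (X : finType) (P : spec T X) u := dualE (G X) P u.
have c'K (X : finType) (P : spec T X) : b' X (c' X P) = P.
  apply: sle_anti; apply/sleP/above_inj => u.
    by move/b'E/c'E; rewrite fK.
  by rewrite -{1}(fK X u) => /c'E/b'E.
have b'K (X : finType) (P : spec T' X) : c' X (b' X P) = P.
  apply: sle_anti; apply/sleP/above_inj => u.
    by move/c'E/b'E; rewrite bK.
  by rewrite -{1}(bK X u) => /b'E/c'E.
constructor; exists c' b' => //.
- move=> X P Q /sleP PQ; apply/sleP/above_inj => u /c'E uP.
  by apply/c'E; exact: upP PQ uP.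
- move=> X P Q /sleP PQ; apply/sleP/above_inj => u /b'E uP.
  by apply/b'E; exact: upP PQ uP.
- move=> X Y f P.
  have natE u : F Y (upset_map (syn_hom T f) u) =
      upset_map (syn_hom T' f) (F X u) :> upset _.
    have e : complete_comp (F Y) (delta_map (syn_hom T f)) =
      complete_comp (delta_map (syn_hom T' f)) (F X) := nat X Y f.
    exact: (delta_hom_congr e).
  have b'_nat (Q : spec T' Y) : b' X (pull f Q) = pull f (b' Y Q).
    have E u : (u : upset (syn_lattice T X)) (b' X (pull f Q)) <->
        (u : upset (syn_lattice T X)) (pull f (b' Y Q)).
      rewrite -b'E -[up_mem u _]/(up_mem (upset_map (syn_hom T f) u) (b' Y Q)).
      by rewrite -b'E natE.
    by apply: sle_anti; apply/sleP/above_inj => u /E.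
  by rewrite -{1}(c'K Y P) -b'_nat b'K.
Qed.

End SpecIso.

(** * Isomorphisms of type spaces and equivalences *)

Section OfSpecIso.
Context (S S' : signature) (T : theory S) (T' : theory S').
Variable a : spec_iso T T'.

Lemma nat_iso_of_spec_iso :
  naturally_isomorphic (syn_doctrine_delta T) (syn_doctrine_delta T').
Proof.
have bwd_mono (X : finType) (P Q : spec T' X) : pf_set P `<=` pf_set Q ->
    pf_set (si_bwd a P) `<=` pf_set (si_bwd a Q).
  by move=> /sleP/(@si_bwd_le _ _ _ _ a)/sleP.
have fwd_mono (X : finType) (P Q : spec T X) : pf_set P `<=` pf_set Q ->
    pf_set (si_fwd a P) `<=` pf_set (si_fwd a Q).
  by move=> /sleP/(@si_fwd_le _ _ _ _ a)/sleP.
constructor.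
exists (fun X : FinSet => preim_hom (bwd_mono X)
    : hom (syn_doctrine_delta T X) (syn_doctrine_delta T' X))
  (fun X : FinSet => preim_hom (fwd_mono X)
    : hom (syn_doctrine_delta T' X) (syn_doctrine_delta T X)).
- move=> X Y f; apply: complete_hom_eq => u; apply: upset_eq => P /=.
  by rewrite -[pfilter_preimage _ P]/(pull f P) si_bwd_natural.
- by move=> X; apply: complete_hom_eq => u; apply: upset_eq => P /=; rewrite si_fwdK.
- by move=> X; apply: complete_hom_eq => u; apply: upset_eq => P /=; rewrite si_bwdK.
Qed.

(** Restates an equation in terms of substitution alone, the form in which [transport_equal] can
    carry it across [a]. *)
Lemma smem_equal_pull X (P : spec T' X) (x y : X) :
  smem P (Equal x y) ->
  pull (fun z => if z == y :> {classic X} then x else z) P = P.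
Proof.
move=> xy; pose r (z : X) : option X :=
  if z == y :> {classic X} then None else Some z.
have yx := smem_eq_sym xy.
have E1 : odflt x \o r = (fun z => if z == y :> {classic X} then x else z).
  by apply/funext => z; rewrite /r /=; case: eqP.
have E2 : odflt y \o r = id.
  by apply/funext => z; rewrite /r /=; case: eqP => //= ->.
apply: spec_eq => phi; rewrite pullE -E1; split=> p.
  have := ent_eq_subst T' x y (subst r phi); rewrite !subst_comp E2 subst_id.
  by move=> /smem_entails; apply; apply/smem_and.
have := ent_eq_subst T' y x (subst r phi); rewrite !subst_comp E2 subst_id.
by move=> /smem_entails; apply; apply/smem_and.
Qed.

(** * Transporting a countable saturated model *)

Section Transport.
Variable M : countable_saturated_model T.

Local Notation tpM := (tp (csm_model M)).
Let Msat : saturated1 M := omega_saturated1 (@csm_saturated _ _ M).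

Definition transport_structure : structure S' :=
  @Structure S' M (fun R x => smem (si_fwd a (tpM x)) (Atom R id)).

Lemma transport_pull (X Y : finType) (f : X -> Y) (v : Y -> M) :
  si_fwd a (tpM (v \o f)) = pull f (si_fwd a (tpM v)).
Proof. by rewrite -pull_tp si_natural. Qed.

(** Extend the type on the [T'] side, carry the extension back to [T], realise it by saturation of
    [M], and return by monotonicity of [si_fwd]. *)
Lemma transport_realise (X : finType) (v : X -> M)
    (F : set (formula S' (option X))) :
  conj_closed F -> (forall phi, F phi -> smem (si_fwd a (tpM v)) (Ex phi)) ->
  exists m : M, forall phi, F phi -> smem (si_fwd a (tpM (oapp v m))) phi.
Proof.
move=> Fc /(spec_lift_ex Fc)[Q [QE QF]].
have [|m mP] := tp_realise (MT := csm_model M) (v := v)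
  (Q := @si_bwd _ _ _ _ a (option X) Q) Msat.
  by rewrite -(@si_bwd_natural _ _ _ _ a X (option X)) QE si_fwdK.
exists m => phi /QF; have := @si_fwd_le _ _ _ _ a (option X) _ _ mP.
by rewrite si_bwdK => /(_ phi).
Qed.

Lemma transport_equal (X : finType) (v : X -> M) x y :
  v x = v y <-> smem (si_fwd a (tpM v)) (Equal x y).
Proof.
pose e (z : X) := if z == y then x else z.
split=> [xy|H].
  rewrite (_ : v = v \o e); last first.
    by apply/funext => z; rewrite /= /e; case: eqP => [->|].
  rewrite transport_pull pullE /= /e eqxx if_same; exact: smem_eq_refl.
have /(congr1 (@si_bwd _ _ _ _ a X)) : pull e (si_fwd a (tpM v)) = si_fwd a (tpM v).
  rewrite -{2}(smem_equal_pull H); congr pull; apply/funext => z; rewrite /e.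
  by case: eqP; case: eqP.
rewrite si_bwd_natural si_fwdK => tv.
apply/(tpE (csm_model M) v (Equal x y)); rewrite -tv pullE [subst _ _]/= /e eqxx if_same.
exact: smem_eq_refl.
Qed.

(** The induction meets contexts that are mere types, whereas [si_fwd] takes finite ones; hence the
    substitution [j] into a finite context. *)
Lemma transport_holds X (phi : formula S' X) (fX : finType) (j : X -> fX)
    (v : fX -> transport_structure) :
  holds (subst j phi) v <-> smem (si_fwd a (tpM v)) (subst j phi).
Proof.
elim: phi fX j v => /= {}X.
- by move=> R x fX j v; rewrite (transport_pull (j \o x) v) pullE.
- by move=> x y fX j v; exact: transport_equal.
- by move=> fX j v; split=> // _; exact: smem_top.
- by move=> fX j v; split=> // /smem_bot.
- by move=> phi IHphi psi IHpsi fX j v; rewrite IHphi IHpsi smem_and.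
- by move=> phi IHphi psi IHpsi fX j v; rewrite IHphi IHpsi smem_or.
- move=> phi IH fX j v; split=> [[m]|p].
    rewrite (IH (option fX)) => /smem_ex.
    by rewrite -(transport_pull Some (oapp v m)).
  have [||m mP] := transport_realise (v := v)
      (F := [set chi | entails T' (subst (omap j) phi) chi]).
  + split; first exact: ent_top.
    by move=> b c; exact: ent_and.
  + move=> chi e; apply: smem_entails p; exact/ent_exl/(ent_trans e)/ent_ex_intro.
  by exists m; rewrite (IH (option fX)); apply: mP; exact: ent_refl.
Qed.

Lemma transport_holds_fin (X : finType) (phi : formula S' X)
    (v : X -> transport_structure) :
  holds phi v <-> smem (si_fwd a (tpM v)) phi.
Proof. by have := transport_holds phi id v; rewrite subst_id. Qed.

Lemma transport_model : model T' transport_structure.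
Proof.
move=> s Ts v; rewrite !transport_holds_fin.
exact/smem_entails/ent_axiom.
Qed.

Lemma transport_saturated : saturated1 transport_structure.
Proof.
move=> X tau v tauI tauE; have [|m mP] := transport_realise (v := v) tauI.
  by move=> phi /tauE/(transport_holds_fin (Ex phi)).
by exists m => phi /mP/transport_holds_fin.
Qed.

Definition transport : countable_saturated_model T' :=
  CountableSaturatedModel transport_model (@csm_countable _ _ M)
    (saturated1_omega transport_saturated).

Lemma tp_transport (X : finType) (v : X -> M) :
  tp (csm_model transport) v = si_fwd a (tpM v).
Proof. by apply: spec_eq => phi; rewrite tpE transport_holds_fin. Qed.

End Transport.

Lemma tp_hom (M N : countable_saturated_model T) (h : structure_hom M N) X
    (v : X -> M) : sle (tp (csm_model M) v) (tp (csm_model N) (h \o v)).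
Proof. by move=> phi /tpE p; apply/tpE/hom_holds. Qed.

Definition transport_hom (M N : countable_saturated_model T)
    (h : structure_hom M N) : structure_hom (transport M) (transport N).
Proof.
refine (@StructureHom S' (transport M) (transport N) (shom h) _) => R x.
apply: (@si_fwd_le _ _ _ _ a _ _ _); exact: tp_hom.
Defined.

Definition transport_functor : functor (omegaSat T) (omegaSat T').
Proof.
refine (@Functor (omegaSat T) (omegaSat T') (fun M => transport M)
  (fun M N h => transport_hom h) _ _); by move=> *; exact: structure_hom_eq.
Defined.

End OfSpecIso.

(** Serves the triangles over sets, whose two sides agree on objects and morphisms by
    computation. *)
Lemma functor_irrelevance (C D : category) (o : C -> D)
    (m : forall x y : C, hom x y -> hom (o x) (o y)) p1 p2 q1 q2 :
  @Functor C D o m p1 q1 = @Functor C D o m p2 q2.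
Proof. by congr Functor; exact: Prop_irrelevance. Qed.

Section EquivalenceOfSpecIso.
Context (S S' : signature) (T : theory S) (T' : theory S').
Variable a : spec_iso T T'.

Lemma interp_transportK (M : countable_saturated_model T) (R : S)
    (x : 'I_(arity R) -> M) :
  interp (transport (spec_iso_sym a) (transport a M)) R x <-> interp M R x.
Proof.
rewrite -[X in X <-> _]/(smem
  (si_bwd a (tp (csm_model (transport a M)) x : spec T' 'I_(arity R))) (Atom R id)).
by rewrite (tp_transport a x) si_fwdK tpE.
Qed.

Lemma interp_Ktransport (N : countable_saturated_model T') (R : S')
    (x : 'I_(arity R) -> N) :
  interp (transport a (transport (spec_iso_sym a) N)) R x <-> interp N R x.
Proof.
rewrite -[X in X <-> _]/(smem (si_fwd a
  (tp (csm_model (transport (spec_iso_sym a) N)) x : spec T 'I_(arity R))) (Atom R id)).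
by rewrite (tp_transport (spec_iso_sym a) x) si_bwdK tpE.
Qed.

Lemma equivalent_of_spec_iso : equivalent_over (forget T) (forget T').
Proof.
pose F := transport_functor a; pose G := transport_functor (spec_iso_sym a).
pose eta1 (M : countable_saturated_model T) : structure_hom (G (F M)) M :=
  @StructureHom S (G (F M)) M id (fun R x => (@interp_transportK M R x).1).
pose eta2 (M : countable_saturated_model T) : structure_hom M (G (F M)) :=
  @StructureHom S M (G (F M)) id (fun R x => (@interp_transportK M R x).2).
pose eps1 (N : countable_saturated_model T') : structure_hom (F (G N)) N :=
  @StructureHom S' (F (G N)) N id (fun R x => (@interp_Ktransport N R x).1).
pose eps2 (N : countable_saturated_model T') : structure_hom N (F (G N)) :=
  @StructureHom S' N (F (G N)) id (fun R x => (@interp_Ktransport N R x).2).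
have [eta etaE] : exists eta :
    nat_iso (comp_functor G F) (id_functor (omegaSat T)), forall M, ni_fwd eta M = eta1 M.
  unshelve eexists (@NatIso _ _ (comp_functor G F) (id_functor (omegaSat T))
    eta1 eta2 _ _ _) => //; by move=> *; exact: structure_hom_eq.
have [eps epsE] : exists eps :
    nat_iso (comp_functor F G) (id_functor (omegaSat T')), forall N, ni_fwd eps N = eps1 N.
  unshelve eexists (@NatIso _ _ (comp_functor F G) (id_functor (omegaSat T'))
    eps1 eps2 _ _ _) => //; by move=> *; exact: structure_hom_eq.
exists F, G, eta, eps; split.
- exact: functor_irrelevance.
- exact: functor_irrelevance.
- by move=> M; rewrite etaE; exact: (@IsIdentity Sets (csm_structure M)).
- by move=> N; rewrite epsE; exact: (@IsIdentity Sets (csm_structure N)).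
Qed.

End EquivalenceOfSpecIso.

(** * Recovering the type spaces from an equivalence *)

Definition cast (A B : Type) (e : A = B) : A -> B :=
  match e in _ = B return A -> B with erefl => id end.

Lemma cast_cast (A B C : Type) (e : A = B) (e' : B = C) x :
  cast e' (cast e x) = cast (etrans e e') x.
Proof. by case: _ / e'. Qed.

Lemma is_identity_cast (A B : Sets) (f : hom A B) : is_identity f ->
  forall (e : B = A) b, f (cast e b) = b.
Proof. by move=> H; case: H => x e b; rewrite (Prop_irrelevance e erefl). Qed.

(** A triangle commutes by a propositional equality, so elements of [M] and [F M] are compared along
    a cast. *)
Lemma functor_eq_cast (C : category) (K L : functor C Sets) : K = L ->
  exists e : forall x, L x = K x :> Type, forall x y (f : hom x y) u,
    fmap K f (cast (e x) u) = cast (e y) (fmap L f u).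
Proof. by move=> ->; exists (fun=> erefl). Qed.

Section FunctorOnSpec.
Context (S S' : signature) (T : theory S) (T' : theory S').
Hypothesis T_stable : omega_stable T.
Variable F : functor (omegaSat T) (omegaSat T').
Variable e : forall M : countable_saturated_model T,
  M -> (F M : countable_saturated_model T').
Hypothesis e_natural : forall (M N : countable_saturated_model T)
  (h : structure_hom M N) m,
  shom (fmap F (h : @hom (omegaSat T) M N)) (e m) = e (h m).

Local Notation mtp M := (tp (@csm_model _ _ M)).

(** [extend_to_hom] gives a homomorphism sending [v] to [w]; its image under [F] acts in the same
    way on elements, by [e_natural]. *)
Lemma functor_tp_le (X : finType) (M N : countable_saturated_model T)
    (v : X -> M) (w : X -> N) :
  sle (mtp M v) (mtp N w) -> sle (mtp (F M) (@e M \o v)) (mtp (F N) (@e N \o w)).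
Proof.
move=> vw; have [h hE] := extend_to_hom
  (omega_saturated1 (csm_saturated (c := N))) (csm_countable M)
  (fun phi p => (tpE (csm_model N) w phi).1 (vw phi ((tpE (csm_model M) v phi).2 p))).
have -> : @e N \o w = shom (fmap F (h : @hom (omegaSat T) M N)) \o (@e M \o v).
  by apply/funext => x /=; rewrite e_natural hE.
exact: tp_hom.
Qed.

Lemma functor_spec (X : finType) (P : spec T X) : exists Q : spec T' X,
  forall (M : countable_saturated_model T) (v : X -> M),
    mtp M v = P -> mtp (F M) (@e M \o v) = Q.
Proof.
have [N [w wE]] := spec_realised_countable P T_stable.
have {wE} <- : mtp N w = P by apply: spec_eq => phi; rewrite tpE.
exists (mtp (F N) (@e N \o w)) => M v vw.
by apply: sle_anti; apply: functor_tp_le; rewrite vw.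
Qed.

Definition on_spec (X : finType) (P : spec T X) : spec T' X :=
  sval (cid (functor_spec P)).

Lemma on_specE (X : finType) (M : countable_saturated_model T) (v : X -> M) :
  on_spec (mtp M v) = mtp (F M) (@e M \o v).
Proof. by apply/esym; exact: (svalP (cid (functor_spec _))). Qed.

Lemma spec_ind (X : finType) (Pr : spec T X -> Prop) :
  (forall (M : countable_saturated_model T) (v : X -> M), Pr (mtp M v)) ->
  forall P, Pr P.
Proof.
move=> H P; have [N [w wE]] := spec_realised_countable P T_stable.
have <- : mtp N w = P by apply: spec_eq => phi; rewrite tpE.
exact: H.
Qed.

Lemma on_spec_le (X : finType) (P Q : spec T X) :
  sle P Q -> sle (on_spec P) (on_spec Q).
Proof.
elim/spec_ind: P => M v; elim/spec_ind: Q => N w.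
rewrite !on_specE; exact: functor_tp_le.
Qed.

Lemma on_spec_natural (X Y : finType) (f : X -> Y) (P : spec T Y) :
  on_spec (pull f P) = pull f (on_spec P).
Proof. by elim/spec_ind: P => M v; rewrite pull_tp !on_specE pull_tp. Qed.

End FunctorOnSpec.

(** The components of [eta] and of its inverse send [v] and its copy in [G (F M)] to each other, so
    the two tuples have the same type. *)
Lemma on_specK (S S' : signature) (T : theory S) (T' : theory S')
    (F : functor (omegaSat T) (omegaSat T'))
    (G : functor (omegaSat T') (omegaSat T))
    (eF : forall M : omegaSat T, forget T M = forget T' (F M) :> Type)
    (eG : forall N : omegaSat T', forget T' N = forget T (G N) :> Type)
    (F_nat : forall (M N : omegaSat T) (h : hom M N) u,
       fmap (forget T') (fmap F h) (cast (eF M) u) =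
         cast (eF N) (fmap (forget T) h u))
    (G_nat : forall (M N : omegaSat T') (h : hom M N) u,
       fmap (forget T) (fmap G h) (cast (eG M) u) =
         cast (eG N) (fmap (forget T') h u))
    (eta : nat_iso (comp_functor G F) (id_functor (omegaSat T)))
    (T_stable : omega_stable T) (T'_stable : omega_stable T') :
  (forall M, is_identity (fmap (forget T) (ni_fwd eta M))) ->
  forall X : finType,
  cancel (@on_spec _ _ _ _ T_stable F (fun M => cast (eF M)) F_nat X)
    (@on_spec _ _ _ _ T'_stable G (fun M => cast (eG M)) G_nat X).
Proof.
move=> etaI X; elim/(spec_ind T_stable) => M v; rewrite !on_specE.
set w := _ \o _; have wE : fmap (forget T) (ni_fwd eta M) \o w = v.
  by apply/funext => x; rewrite /w /= cast_cast; exact: (is_identity_cast (etaI M)).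
apply: sle_anti; first by rewrite -wE; exact: tp_hom.
have -> : w = shom (ni_bwd eta M) \o v; last exact: tp_hom.
rewrite -wE; apply/funext => x.
exact: (congr1 (fun h : structure_hom _ _ => h (w x)) (esym (ni_fwdK eta M))).
Qed.

Lemma spec_iso_of_equivalent (S S' : signature) (T : theory S)
    (T' : theory S') : omega_stable T -> omega_stable T' ->
  equivalent_over (forget T) (forget T') -> inhabited (spec_iso T T').
Proof.
move=> T_stable T'_stable [F [G [eta [eps [VF UG etaI epsI]]]]].
have [eF F_nat] := functor_eq_cast VF; have [eG G_nat] := functor_eq_cast UG.
constructor; exists
  (@on_spec _ _ _ _ T_stable F (fun M => cast (eF M)) F_nat)
  (@on_spec _ _ _ _ T'_stable G (fun M => cast (eG M)) G_nat).
- exact: (on_specK F_nat G_nat T_stable T'_stable etaI).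
- exact: (on_specK G_nat F_nat T'_stable T_stable epsI).
- exact: on_spec_le.
- exact: on_spec_le.
- exact: on_spec_natural.
Qed.

Theorem corollary6p9 (S S' : signature) (T : theory S) (T' : theory S')
    (T_stable : omega_stable T) (T'_stable : omega_stable T') :
  naturally_isomorphic (syn_doctrine_delta T) (syn_doctrine_delta T') <->
  equivalent_over (forget T) (forget T').
Proof.
split=> [[/spec_iso_of_nat_iso[a]]|].
  exact: equivalent_of_spec_iso a.
by move=> /(spec_iso_of_equivalent T_stable T'_stable)[a]; exact: nat_iso_of_spec_iso a.
Qed.
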